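(* Fix $n\ge1$, weights $a_1,\dots,a_n>0$ and limiting proportions $p_1,\dots,p_n\ge0$ with $p_1>0$ and $\sum_ip_i=1$. For $\gamma>1$ let $\mathcal{E}_\gamma(\beta)$ be the (almost sure) limiting free energy of the $n$-level generalized random energy model with driving density $\phi_{N,\gamma}$, and let $\mathcal{E}(\beta)$ be the (almost sure) limiting free energy of the $n$-level generalized random energy model with two-sided exponential driving distribution $\phi_{N,1}$; explicit formulas are given in the context. Then for all $\beta\ge0$, $$\lim_{\gamma\downarrow1}\mathcal{E}_\gamma(\beta)=\mathcal{E}(\beta).$$
   Context: Model: for each $N\ge n$ let $k(1,N),\dots,k(n,N)\ge1$ be integers with $\sum_ik(i,N)=N$ and $\frac{k(i,N)}N\to p_i$. Write $\sigma\in\{+1,-1\}^N$ as $\sigma_1\cdots\sigma_n$, $\sigma_i\in\{+1,-1\}^{k(i,N)}$. For each $N$ the variables $\xi(\sigma_1\cdots\sigma_i)$ are i.i.d. with density $\phi_{N,\gamma}(x)=\frac1{2\Gamma(1/\gamma)}(\gamma/N)^{(\gamma-1)/\gamma}e^{-|x|^\gamma/(\gamma N^{\gamma-1})}$ (for $\gamma=1$: $\frac12e^{-|x|}$); $H_N(\sigma)=\sum_ia_i\xi(\sigma_1\cdots\sigma_i)$, $Z_N(\beta)=\sum_\sigma e^{-\beta H_N(\sigma)}$, and the limiting free energy is the almost sure limit of $\frac1N\log Z_N(\beta)$, a nonrandom quantity. Formula for $\mathcal{E}_\gamma$, $\gamma>1$: put $B(j,k)=\left(\frac{(p_j+\cdots+p_k)\gamma\log2}{a_j^{\gamma/(\gamma-1)}+\cdots+a_k^{\gamma/(\gamma-1)}}\right)^{(\gamma-1)/\gamma}$;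 $r_0=0$, $\beta_{l+1}=\min_{k>r_l}B(r_l+1,k)$, $r_{l+1}=\max\{i>r_l:B(r_l+1,i)=\beta_{l+1}\}$, until $r_K=n$; $\beta_0=0$, $\beta_{K+1}=\infty$ (these depend on $\gamma$). Then $\mathcal{E}_\gamma(0)=\log2$ and for $\beta_j<\beta\le\beta_{j+1}$, $0\le j\le K$ (with $\beta<\infty$), $$\mathcal{E}_\gamma(\beta)=\sum_{i=r_j+1}^np_i\log2+\frac{\gamma-1}\gamma\sum_{i=r_j+1}^n(\beta a_i)^{\frac\gamma{\gamma-1}}+\beta\sum_{l=1}^j\beta_l^{\frac1{\gamma-1}}\sum_{i=r_{l-1}+1}^{r_l}a_i^{\frac\gamma{\gamma-1}}.$$ Formula for $\mathcal{E}$: put $r_0=0$, $\beta_0=0$, $\beta_k=\min\{\frac1{a_i}:r_{k-1}<i\le n\}$, $r_k=\max\{i:r_{k-1}<i\le n,\frac1{a_i}=\beta_k\}$, until $r_K=n$; $\beta_{K+1}=\infty$. Then $\mathcal{E}(\beta)=\log2$ for $0\le\beta<\beta_1$ and $\mathcal{E}(\beta)=\log2+\sum_{l=1}^j(\beta a_{r_l}-1)\sum_{i=r_{l-1}+1}^{r_l}p_i\log2$ for $\beta_j\le\beta<\beta_{j+1}$, $1\le j\le K$. *)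

(* Defs.v *)
(* MathComp-Analysis, over an arbitrary R : realType.
   Levels are numbered 1, ..., n as in the usual presentation of the model:
   level-indexed data are functions on nat, used at the indices 1..n only. *)
From HB Require Import structures.
From mathcomp Require Import all_boot all_order all_algebra.
From mathcomp Require Import all_classical all_reals all_analysis.
Set Implicit Arguments.
Unset Strict Implicit.
Unset Printing Implicit Defensive.
Import Order.TTheory GRing.Theory Num.Theory.
Import numFieldNormedType.Exports.
Local Open Scope classical_set_scope.
Local Open Scope ring_scope.

Section Model.
Context {R : realType}.

Definition Euler_Gamma (s : R) : R :=
  \int[@lebesgue_measure R]_(t in `]0, +oo[) (t `^ (s - 1) * expR (- t)).

Definition phi (N : nat) (g x : R) : R :=
  (2 * Euler_Gamma g^-1)^-1 * (g / N%:R) `^ ((g - 1) / g)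
  * expR (- (`|x| `^ g / (g * N%:R `^ (g - 1)))).

Section Disorder.
Context {d : measure_display} {T : measurableType d} (P : probability T R).

Definition mutually_independent (I : eqType) (A : set I)
    (X : I -> {RV P >-> R}) : Prop :=
  forall (s : seq I) (B : I -> set R),
    uniq s -> (forall i, i \in s -> A i) -> (forall i, measurable (B i)) ->
    (P (\bigcap_(i in [set` s]) (X i @^-1` B i))
     = \prod_(i <- s) P (X i @^-1` B i))%E.

Definition iid_with_density (I : eqType) (A : set I) (f : R -> R)
    (X : I -> {RV P >-> R}) : Prop :=
  mutually_independent A X /\
  forall i, A i -> forall B : set R, measurable B ->
    distribution P (X i) B = (\int[lebesgue_measure]_(x in B) (f x)%:E)%E.

(* A configuration of N spins is an N-tuple of booleans (true for +1, false
   for -1), and sigma_1 ... sigma_i is its prefix of length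
   k(1,N) + ... + k(i,N). *)
Definition prefix_length (k : nat -> nat -> nat) (N i : nat) : nat :=
  (\sum_(1 <= j < i.+1) k j N)%N.

Definition level_prefix (k : nat -> nat -> nat) (N i : nat) (sigma : seq bool)
  : seq bool := take (prefix_length k N i) sigma.

(* Since k(i,N) >= 1, words of different levels have different lengths, so that
   the word alone identifies the variable xi(sigma_1 ... sigma_i). *)
Definition level_words (n : nat) (k : nat -> nat -> nat) (N : nat)
  : set (seq bool) :=
  [set w | exists i, (1 <= i <= n)%N /\ size w = prefix_length k N i].

Definition Hamiltonian (n : nat) (a : nat -> R) (k : nat -> nat -> nat)
    (xi : nat -> seq bool -> T -> R) (N : nat) (sigma : N.-tuple bool) (w : T)
  : R := \sum_(1 <= i < n.+1) a i * xi N (level_prefix k N i sigma) w.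

Definition partition_function (n : nat) (a : nat -> R)
    (k : nat -> nat -> nat) (xi : nat -> seq bool -> T -> R) (beta : R)
    (N : nat) (w : T) : R :=
  \sum_(sigma : N.-tuple bool) expR (- (beta * Hamiltonian n a k xi sigma w)).

(* xi N is the disorder of the system of size N; nothing is required of the
   joint law for different N. *)
Definition GREM_disorder (n : nat) (k : nat -> nat -> nat) (g : R)
    (xi : nat -> seq bool -> {RV P >-> R}) : Prop :=
  forall N, (n <= N)%N ->
    iid_with_density (level_words n k N) (phi N g) (xi N).

Definition limiting_free_energy (n : nat) (a : nat -> R)
    (k : nat -> nat -> nat) (xi : nat -> seq bool -> {RV P >-> R})
    (beta e : R) : Prop :=
  {ae P, forall w,
    N%:R^-1 * ln (partition_function n a k (fun N s => xi N s) beta N w)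
      @[N --> \oo] --> e}.

End Disorder.

Definition admissible_sizes (n : nat) (p : nat -> R) (k : nat -> nat -> nat)
  : Prop :=
  [/\ forall N i, (n <= N)%N -> (1 <= i <= n)%N -> (1 <= k i N)%N,
      forall N, (n <= N)%N -> (\sum_(1 <= i < n.+1) k i N)%N = N &
      forall i, (1 <= i <= n)%N ->
        (k i N)%:R / N%:R @[N --> \oo] --> p i].

End Model.

Section ExplicitFormulas.
Context {R : realType}.
Variable n : nat.

(* The recursion shared by the two formulas:
     r_0 = 0,  beta_{l+1} = min_{r_l < i <= n} B (r_l + 1) i,
     r_{l+1} = max {i in (r_l, n] : B (r_l + 1) i = beta_{l+1}},
   stopped at the first K with r_K = n (r is constant from there on). *)
Section Blocks.
Variable B : nat -> nat -> R.

Definition block_min (r : nat) : R :=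
  \big[Num.min/B r.+1 n]_(r.+1 <= i < n.+1) B r.+1 i.

Fixpoint block_end (l : nat) : nat :=
  if l is l'.+1 then
    let r := block_end l' in
    if (r < n)%N then
      (\max_(r.+1 <= i < n.+1 | B r.+1 i == block_min r) i)%N
    else r
  else 0%N.

Definition beta_crit (l : nat) : R :=
  if l is l'.+1 then block_min (block_end l') else 0.

(* r increases strictly until it reaches n, so K <= n. *)
Definition nblocks : nat :=
  find (fun l => block_end l == n) (iota 0 n.+1).

End Blocks.

Definition Bgamma (a p : nat -> R) (g : R) (j k : nat) : R :=
  ((\sum_(j <= i < k.+1) p i) * g * ln 2
   / \sum_(j <= i < k.+1) a i `^ (g / (g - 1))) `^ ((g - 1) / g).

(* In the two definitions below the condition j == nblocks _ accounts for
   beta_{K+1} = +oo, and the interval containing b is selected by listing all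
   suitable j (there is exactly one). *)
Definition free_energy_gamma (a p : nat -> R) (g b : R) : R :=
  let r := block_end (Bgamma a p g) in
  let beta := beta_crit (Bgamma a p g) in
  let K := nblocks (Bgamma a p g) in
  if b == 0 then ln 2 else
  let j := head 0%N [seq j <- iota 0 K.+1 |
                      (beta j < b) && ((j == K) || (b <= beta j.+1))] in
  \sum_((r j).+1 <= i < n.+1) p i * ln 2
  + (g - 1) / g * \sum_((r j).+1 <= i < n.+1) (b * a i) `^ (g / (g - 1))
  + b * \sum_(1 <= l < j.+1)
          (beta l `^ (g - 1)^-1
           * \sum_((r l.-1).+1 <= i < (r l).+1) a i `^ (g / (g - 1))).

Definition Bexp (a : nat -> R) (j i : nat) : R := (a i)^-1.

Definition free_energy_exp (a p : nat -> R) (b : R) : R :=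
  let r := block_end (Bexp a) in
  let beta := beta_crit (Bexp a) in
  let K := nblocks (Bexp a) in
  if b < beta 1%N then ln 2 else
  let j := head 0%N [seq j <- iota 1 K |
                      (beta j <= b) && ((j == K) || (b < beta j.+1))] in
  ln 2 + \sum_(1 <= l < j.+1)
           ((b * a (r l) - 1)
            * \sum_((r l.-1).+1 <= i < (r l).+1) p i * ln 2).

End ExplicitFormulas.

(* Main.v *)
Require Import Defs.
From HB Require Import structures.
From mathcomp Require Import all_boot all_order all_algebra.
From mathcomp Require Import all_classical all_reals all_analysis.
From mathcomp Require Import measurable_realfun ring lra zify.
Set Implicit Arguments.
Unset Strict Implicit.
Unset Printing Implicit Defensive.
Import Order.TTheory GRing.Theory Num.Theory.
Import numFieldNormedType.Exports.
Local Open Scope classical_set_scope.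
Local Open Scope ring_scope.

(** The two halves of the statement rest on different ideas.

    The models. The free energies converge because the disorders themselves do,
    so that no formula for the limits is needed. On the scale x = N y the density
    phi_(N,g) decays like exp(- N |y|^g / g), and |y|^g / g tends to |y| uniformly
    on bounded sets as g decreases to 1. Hence the monotone map that transports
    phi_(N,g) to the two-sided exponential law moves every point of [-3N, 3N] by at
    most a small multiple of N ([quantile_close]). There are at most n 2^N disorder
    variables, and each leaves [-3N, 3N] with probability at most a constant times
    e^(-2N) ([survival_far]), so that all of them stay inside with high
    probability. As the two models may live on unrelated probability spaces, the
    transport is realized by discretization: cut the line for phi_(N,g) at the
    points of a fine grid, and for the exponential law at the points with the same
    tail probabilities. By independence the vector of cells has the same law in
    both models; therefore two events of large probability, one on each side,
    contain points with the same vector of cells ([coupling_by_cells]), that is,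
    with close disorders ([coupled_disorder]). The Hamiltonian is Lipschitz in the
    disorder, so taking for these events that the free energies are close to their
    limits gives |E g b - E 1 b| <= b (a_1 + ... + a_n) modulus(g)
    ([free_energy_close]), and modulus(g) tends to 0.

    The formulas. Both are instances of one functional: with beta(i) the critical
    value of the block that contains the level i, the energy is log 2 times the
    sum of the p_i max(1, b / beta(i)). For [free_energy_exp] this is exact and
    1 / beta(i) = M_i, the maximum of a_i, ..., a_n ([free_energy_expE]). For
    [free_energy_gamma] it holds up to a factor between 1 and g and an error of at
    most (g - 1) log 2 ([free_energy_gammaE]). The blocks need not converge as g
    decreases to 1, but the critical values do: beta(i) lies between two explicit
    quantities that tend to 1 / M_i whenever p_i > 0. The upper one is a bound for
    the minimized ratio at an index where the maximum is attained, the lower one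
    comes from the mediant inequality ([beta_gamma_le], [beta_gamma_ge]); levels
    with p_i = 0 contribute nothing. *)

(** * The block recursion *)

Section Blocks.
Context {R : realType}.
Variables (n : nat) (B : nat -> nat -> R).

Local Notation r := (block_end n B).
Local Notation beta := (beta_crit n B).
Local Notation K := (nblocks n B).

Lemma block_min_le s i : (s < i <= n)%N -> block_min n B s <= B s.+1 i.
Proof.
move=> si; rewrite /block_min.
have : i \in index_iota s.+1 n.+1 by rewrite mem_index_iota ltnS.
elim: (index_iota _ _) => // j l IH; rewrite inE big_cons => /orP[/eqP->|/IH h].
  by rewrite ge_min lexx.
by rewrite ge_min h orbT.
Qed.

Lemma block_min_attained s : (s < n)%N ->
  exists2 i, (s < i <= n)%N & B s.+1 i = block_min n B s.
Proof.
move=> sn; rewrite /block_min big_seq_cond.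
apply: (big_ind (fun x => exists2 i, (s < i <= n)%N & B s.+1 i = x)).
- by exists n; rewrite ?sn /=.
- by move=> x y hx hy; rewrite minElt; case: ifP.
- by move=> i; rewrite mem_index_iota ltnS andbT => ?; exists i.
Qed.

Lemma block_end_step l : (r l < n)%N ->
  [/\ (r l < r l.+1 <= n)%N, B (r l).+1 (r l.+1) = beta l.+1 &
      forall i, (r l.+1 < i <= n)%N -> beta l.+1 < B (r l).+1 i].
Proof.
move=> ln /=; rewrite ln; set s := r l; set m := (\max_(_ <= i < _ | _) i)%N.
have memP i : (s < i <= n)%N -> B s.+1 i = block_min n B s -> (i <= m)%N.
  move=> si e; apply: (leq_bigmax_seq i); last by rewrite e eqxx.
  by rewrite mem_index_iota ltnS.
have [i0 si0 ei0] := block_min_attained ln.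
have [mP me] : (s < m <= n)%N /\ B s.+1 m = block_min n B s.
  suff : m = 0%N \/ ((s < m <= n)%N /\ B s.+1 m = block_min n B s).
    case=> // m0; have := memP _ si0 ei0; rewrite m0; lia.
  rewrite /m big_nat_cond.
  apply: (big_ind (fun x => x = 0%N \/
    ((s < x <= n)%N /\ B s.+1 x = block_min n B s))).
  - by left.
  - by move=> x y hx hy; case: (leqP x y).
  - by move=> i /andP[]; rewrite ltnS => ? /eqP; right.
split=> // i /andP[mi ni]; rewrite lt_neqAle block_min_le ?ni ?andbT; last lia.
apply/eqP => e; have := memP i; rewrite -e ni andbT => /(_ _ erefl).
lia.
Qed.

Lemma block_end_le l : (r l <= n)%N.
Proof.
elim: l => // l IH; have [h|h] := ltnP (r l) n.
  by have [/andP[]] := block_end_step h.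
by rewrite /= ltnNge h.
Qed.

Lemma block_end_homo : {homo r : l m / (l <= m)%N}.
Proof.
apply: homo_leq => //; first exact: leq_trans.
move=> l; have [h|h] := ltnP (r l) n; last by rewrite /= ltnNge h.
by have [/andP[/ltnW]] := block_end_step h.
Qed.

Let block_end_ge l : (minn l n <= r l)%N.
Proof.
elim: l => [|l IH]; first by rewrite min0n.
have [h|h] := ltnP (r l) n; first by have [/andP[]] := block_end_step h; lia.
have := block_end_homo (leqnSn l); lia.
Qed.

Lemma nblocksP : r K = n /\ forall l, (l < K)%N -> (r l < n)%N.
Proof.
have hasn : has (fun l => r l == n) (iota 0 n.+1).
  apply/hasP; exists n; first by rewrite mem_iota /= add0n ltnSn.
  by have := block_end_ge n; rewrite minnn eqn_leq block_end_le.
have Kn : (K < n.+1)%N by move: hasn; rewrite has_find size_iota.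
have := nth_find 0%N hasn; rewrite nth_iota // add0n => /eqP rK.
split=> // l lK; rewrite ltn_neqAle block_end_le andbT.
have := before_find 0%N lK; rewrite nth_iota ?add0n; last exact: ltn_trans Kn.
by move=> ->.
Qed.

Lemma nblocks_gt0 : (0 < n)%N -> (0 < K)%N.
Proof.
have [+ _] := nblocksP; case: K => //= rK.
by move: (rK) => <-.
Qed.

Lemma big_blocks (F : nat -> R) j k : (j <= k)%N ->
  \sum_((r j).+1 <= i < (r k).+1) F i
  = \sum_(j.+1 <= l < k.+1) \sum_((r l.-1).+1 <= i < (r l).+1) F i.
Proof.
elim: k => [|k IH]; first by rewrite leqn0 => /eqP ->; rewrite !big_geq.
rewrite leq_eqVlt => /predU1P[->|]; first by rewrite !big_geq.
rewrite ltnS => jk; rewrite [RHS]big_nat_recr ?ltnS // -IH //.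
by apply: big_cat_nat; rewrite ltnS; apply: block_end_homo.
Qed.

Lemma big_levels (F : nat -> R) :
  \sum_(1 <= i < n.+1) F i
  = \sum_(1 <= l < K.+1) \sum_((r l.-1).+1 <= i < (r l).+1) F i.
Proof.
have [rK _] := nblocksP.
have -> : \sum_(1 <= i < n.+1) F i = \sum_((r 0).+1 <= i < (r K).+1) F i.
  by rewrite rK.
exact: big_blocks.
Qed.

Lemma in_block_bounds l i : ((r l.-1).+1 <= i < (r l).+1)%N -> (1 <= i <= n)%N.
Proof.
by move=> /andP[h1 h2]; have := block_end_le l; lia.
Qed.

(** The common form of both energies, divided by log 2: below its critical value
    a block contributes its weight, above it its weight times b / beta_l. *)
Definition block_functional (p : nat -> R) (b : R) : R :=
  \sum_(1 <= l < K.+1) \sum_((r l.-1).+1 <= i < (r l).+1)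
     p i * Num.max 1 (b / beta l).

(** As the critical values increase, the blocks whose critical value is below b
    are the first j ones, which is how the explicit formulas are written. *)
Lemma block_functionalE (p : nat -> R) b j : (j <= K)%N ->
  (forall l, (1 <= l <= K)%N -> 0 < beta l) ->
  (forall l, (1 <= l <= j)%N -> beta l <= b) ->
  (forall l, (j < l <= K)%N -> b <= beta l) ->
  block_functional p b =
  \sum_((r j).+1 <= i < n.+1) p i
  + \sum_(1 <= l < j.+1) (b / beta l * \sum_((r l.-1).+1 <= i < (r l).+1) p i).
Proof.
move=> jK b0 lo hi; rewrite /block_functional (@big_cat_nat _ _ _ j.+1) //=.
rewrite addrC; congr (_ + _); last first.
  apply: eq_big_nat => l /andP[l1]; rewrite ltnS => lj.
  rewrite mulr_sumr; apply: eq_bigr => i _; rewrite mulrC.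
  by rewrite max_r // ler_pdivlMr ?mul1r ?lo ?b0 ?l1 ?(leq_trans lj).
have [rK _] := nblocksP.
have -> : \sum_((r j).+1 <= i < n.+1) p i = \sum_((r j).+1 <= i < (r K).+1) p i.
  by rewrite rK.
rewrite big_blocks //.
apply: eq_big_nat => l /andP[l1]; rewrite ltnS => lK.
apply: eq_bigr => i _; rewrite max_l ?mulr1 //.
by rewrite ler_pdivrMr ?mul1r ?hi ?b0 ?l1 ?lK //; lia.
Qed.

Lemma eq_block_functional (p M : nat -> R) b :
  (forall l i, (1 <= l <= K)%N -> ((r l.-1).+1 <= i < (r l).+1)%N ->
    p i * Num.max 1 (b / beta l) = p i * Num.max 1 (b * M i)) ->
  block_functional p b = \sum_(1 <= i < n.+1) p i * Num.max 1 (b * M i).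
Proof.
move=> h; rewrite big_levels; apply: eq_big_nat => l lK.
by apply: eq_big_nat => i ri; apply: h.
Qed.

Lemma block_functional_le (p M : nat -> R) b :
  (forall l i, (1 <= l <= K)%N -> ((r l.-1).+1 <= i < (r l).+1)%N ->
    p i * Num.max 1 (b / beta l) <= p i * Num.max 1 (b * M i)) ->
  block_functional p b <= \sum_(1 <= i < n.+1) p i * Num.max 1 (b * M i).
Proof.
move=> h; rewrite big_levels; apply: ler_sum_nat => l lK.
by apply: ler_sum_nat => i ri; apply: h.
Qed.

Lemma block_functional_ge (p M : nat -> R) b :
  (forall l i, (1 <= l <= K)%N -> ((r l.-1).+1 <= i < (r l).+1)%N ->
    p i * Num.max 1 (b * M i) <= p i * Num.max 1 (b / beta l)) ->
  \sum_(1 <= i < n.+1) p i * Num.max 1 (b * M i) <= block_functional p b.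
Proof.
move=> h; rewrite big_levels; apply: ler_sum_nat => l lK.
by apply: ler_sum_nat => i ri; apply: h.
Qed.

Hypothesis beta_lt : forall l, (0 < l < K)%N -> beta l < beta l.+1.

Lemma beta_crit_gt0 l : 0 < beta 1 -> (1 <= l <= K)%N -> 0 < beta l.
Proof.
move=> beta1; elim: l => [//|[|l] IH] // h; apply: (lt_trans (IH _)); first by lia.
by apply: beta_lt; lia.
Qed.

Lemma beta_crit_le l m : (1 <= l)%N -> (l <= m <= K)%N -> beta l <= beta m.
Proof.
move=> l1; elim: m => [|m IH]; first by lia.
have [->//|ml h] := eqVneq l m.+1.
apply: (le_trans (IH _)); first by lia.
by apply/ltW/beta_lt; lia.
Qed.

(** The index chosen by the explicit formulas separates the critical values below
    b from those above b; the largest l with beta_l < b passes the test, so that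
    the default value of [head] never appears. *)
Lemma beta_crit_selectlt (b : R) : 0 < b ->
  let j := head 0%N [seq j <- iota 0 K.+1 |
                      (beta j < b) && ((j == K) || (b <= beta j.+1))] in
  [/\ (j <= K)%N, forall l, (1 <= l <= j)%N -> beta l < b &
      forall l, (j < l <= K)%N -> b <= beta l].
Proof.
move=> b0; cbv zeta; set s := [seq _ <- _ | _].
have : s != [::].
  rewrite -has_filter; pose P l := (l <= K)%N && (beta l < b).
  have P0 : P 0%N by rewrite /P /= b0.
  have [|j /andP[jK jb] jmax] := @ex_maxnP P K (ex_intro (fun l => P l) _ P0).
    by move=> l /andP[].
  apply/hasP; exists j; first by rewrite mem_iota /= add0n ltnS.
  rewrite jb /=; have [//|/= jnK] := eqVneq j K.
  rewrite leNgt; apply/negP => h; suff : (j.+1 <= j)%N by rewrite ltnn.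
  by apply: jmax; rewrite /P h andbT; lia.
case es : s => [//|j t] _ /=; have : j \in s by rewrite es mem_head.
rewrite mem_filter mem_iota add0n ltnS => /andP[/andP[jb jn] jK].
split=> // l h.
  by apply: le_lt_trans jb; apply: beta_crit_le; lia.
case/orP: jn => [/eqP jeK|bj]; first by lia.
by apply: (@le_trans _ _ (beta j.+1)) => //; apply: beta_crit_le; lia.
Qed.

Lemma beta_crit_selectle (b : R) : (0 < K)%N -> beta 1 <= b ->
  let j := head 0%N [seq j <- iota 1 K |
                      (beta j <= b) && ((j == K) || (b < beta j.+1))] in
  [/\ (j <= K)%N, forall l, (1 <= l <= j)%N -> beta l <= b &
      forall l, (j < l <= K)%N -> b <= beta l].
Proof.
move=> K0 b1; cbv zeta; set s := [seq _ <- _ | _].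
have : s != [::].
  rewrite -has_filter; pose P l := [&& (0 < l)%N, (l <= K)%N & beta l <= b].
  have P1 : P 1%N by rewrite /P /= K0.
  have [|j /and3P[j0 jK jb] jmax] := @ex_maxnP P K (ex_intro (fun l => P l) _ P1).
    by move=> l /and3P[].
  apply/hasP; exists j; first by rewrite mem_iota j0 add1n ltnS.
  rewrite jb /=; have [//|/= jnK] := eqVneq j K.
  rewrite ltNge; apply/negP => h; suff : (j.+1 <= j)%N by rewrite ltnn.
  by apply: jmax; rewrite /P h andbT; lia.
case es : s => [//|j t] _ /=; have : j \in s by rewrite es mem_head.
rewrite mem_filter mem_iota add1n ltnS => /andP[/andP[jb jn] /andP[j0 jK]].
split=> // l h.
  by apply: le_trans jb; apply: beta_crit_le; lia.
case/orP: jn => [/eqP jeK|bj]; first by lia.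
by apply: (@le_trans _ _ (beta j.+1)); first exact: ltW; apply: beta_crit_le; lia.
Qed.

End Blocks.
(** * The formula for the exponential model *)

Lemma block_end_lt {R : realType} (n : nat) (C : nat -> nat -> R) l : (1 <= l <= nblocks n C)%N ->
  (block_end n C l.-1 < n)%N.
Proof. by move=> h; have [_] := nblocksP n C; apply; lia. Qed.

Section Formulas.
Context {R : realType}.
Variables (n : nat) (a p : nat -> R).
Hypothesis hn : (1 <= n)%N.
Hypothesis ha : forall i, (1 <= i <= n)%N -> 0 < a i.
Hypothesis hp : forall i, (1 <= i <= n)%N -> 0 <= p i.
Hypothesis hp1 : 0 < p 1%N.
Hypothesis hsum : \sum_(1 <= i < n.+1) p i = 1.

Definition tail_max (i : nat) : R := \big[Num.max/a i]_(i <= k < n.+1) a k.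

Lemma tail_max_ge i k : (i <= k <= n)%N -> a k <= tail_max i.
Proof.
move=> ik; have : k \in index_iota i n.+1 by rewrite mem_index_iota ltnS.
rewrite /tail_max; elim: (index_iota _ _) => // j l IH.
rewrite inE big_cons => /orP[/eqP->|/IH h]; first by rewrite le_max lexx.
by rewrite le_max h orbT.
Qed.

Lemma tail_max_attained i : (i <= n)%N ->
  exists2 k, (i <= k <= n)%N & a k = tail_max i.
Proof.
move=> ni; rewrite /tail_max big_seq_cond.
apply: (big_ind (fun x => exists2 k, (i <= k <= n)%N & a k = x)).
- by exists i; rewrite ?leqnn.
- by move=> x y hx hy; rewrite maxElt; case: ifP.
- by move=> k; rewrite mem_index_iota ltnS andbT => ?; exists k.
Qed.

Lemma tail_max_gt0 i : (1 <= i <= n)%N -> 0 < tail_max i.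
Proof.
move=> hi; apply: (lt_le_trans (ha hi)); apply: tail_max_ge.
by case/andP: hi => _ ->; rewrite leqnn.
Qed.

(** The block functional with its blocks forgotten: M i plays the role of the
    inverse critical value of the block of the level i. *)
Definition zero_temperature_energy (M : nat -> R) (b : R) : R :=
  \sum_(1 <= i < n.+1) p i * Num.max 1 (b * M i).

Section Exp.
Local Notation B := (Bexp a).
Local Notation r := (block_end n B).
Local Notation beta := (beta_crit n B).
Local Notation K := (nblocks n B).

Lemma beta_expE l : (1 <= l <= K)%N -> beta l = (a (r l))^-1.
Proof.
case: l => // l lK; have [_ <- _] := block_end_step (block_end_lt lK).
by [].
Qed.

Lemma beta_exp_gt0 l : (1 <= l <= K)%N -> 0 < beta l.
Proof.
move=> h; rewrite beta_expE // invr_gt0 ha // block_end_le andbT.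
case: l h => // l /block_end_lt h; have [/andP[h' _] _ _] := block_end_step h.
by apply: leq_ltn_trans h'.
Qed.

Lemma beta_exp_lt l : (0 < l < K)%N -> beta l < beta l.+1.
Proof.
case: l => // l lK.
have h1 : (1 <= l.+1 <= K)%N by lia.
have h2 : (1 <= l.+2 <= K)%N by lia.
have [h3 e1 m1] := block_end_step (block_end_lt h1).
have [h4 e2 m2] := block_end_step (block_end_lt h2).
by rewrite -e2; apply: m1.
Qed.

(** A block ends at the last index where the maximum of the remaining weights is
    attained, so that the inverse of its critical value is [tail_max] at each of
    its levels. *)
Lemma free_energy_expE b : 0 <= b ->
  free_energy_exp n a p b = ln 2 * zero_temperature_energy tail_max b.
Proof.
move=> b0.
have K0 : (0 < K)%N by apply: nblocks_gt0.
have b1 : 0 < beta 1 by apply: beta_exp_gt0.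
have -> : zero_temperature_energy tail_max b = block_functional n B p b.
  symmetry; apply: eq_block_functional => l i hl hi; congr (_ * Num.max _ (_ * _)).
  rewrite beta_expE // invrK; apply/eqP; rewrite eq_le tail_max_ge; last first.
    by have := block_end_le n B l; move: hi; lia.
  have [k hk <-] : exists2 k, (i <= k <= n)%N & a k = tail_max i.
    by apply: tail_max_attained; case/andP: (in_block_bounds hi).
  case: l hl hi => // l hl hi.
  have h : (r l < r l.+1 <= n)%N by have [] := block_end_step (block_end_lt hl).
  have kn : (r l < k <= n)%N by move: hi hk => /=; lia.
  have := block_min_le B kn.
  rewrite -[block_min n B (r l)]/(beta l.+1) beta_expE // lef_pV2 //.
    by rewrite posrE ha //; lia.
  by rewrite posrE ha //; lia.
rewrite /free_energy_exp; case: ltP => [bb1|b1b].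
  rewrite (@block_functionalE _ _ _ _ _ 0%N) //.
  - by rewrite /= hsum big_geq // addr0 mulr1.
  - exact: beta_exp_gt0.
  - by move=> l h; lia.
  - move=> l h; apply: (le_trans (ltW bb1)). apply: (beta_crit_le beta_exp_lt); lia.
have [] := beta_crit_selectle beta_exp_lt K0 b1b.
set j := head _ _ => jK lo hi.
rewrite (@block_functionalE _ _ _ _ _ j) //; last exact: beta_exp_gt0.
have : \sum_((r 0).+1 <= i < (r K).+1) p i = 1 by rewrite (nblocksP n B).1.
rewrite (@big_cat_nat _ _ _ (r j).+1) ?ltnS ?block_end_homo //=.
rewrite (nblocksP n B).1 (@big_blocks _ _ _ _ 0 j) //.
set X := (X in X + _ = _ -> _); set Y := (X in _ + X = _ -> _) => XY.
have -> : (\sum_(1 <= l < j.+1) (b * a (r l) - 1) *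
    (\sum_((r l.-1).+1 <= i < (r l).+1) p i * ln 2)) =
  ln 2 * (\sum_(1 <= l < j.+1) (b / beta l *
    (\sum_((r l.-1).+1 <= i < (r l).+1) p i)) - X).
  rewrite /X -sumrB mulr_sumr; apply: eq_big_nat => l hl /=.
  by rewrite beta_expE ?invrK -?mulr_suml; [ring|lia].
have -> : X = 1 - Y by rewrite -XY addrK.
by rewrite -/Y; set Z := (\sum_(1 <= l < j.+1) _); ring.
Qed.

End Exp.
End Formulas.
(** * The formula for the models with g > 1 *)

Section PowerRoot.
Context {R : realType}.
Implicit Types q c x : R.

Lemma powRK q x : 0 < q -> 0 <= x -> (x `^ q^-1) `^ q = x.
Proof. by move=> q0 x0; rewrite -powRrM mulVf ?gt_eqF // powRr1. Qed.

Lemma ler_powR2r q x y : 0 < q -> 0 <= x -> 0 <= y ->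
  (x `^ q <= y `^ q) = (x <= y).
Proof.
move=> q0 x0 y0; apply/idP/idP; last first.
  by apply: ge0_ler_powR; rewrite ?nnegrE // ltW.
by apply: contraTT; rewrite -!ltNge; apply: gt0_ltr_powR; rewrite ?nnegrE.
Qed.

Lemma powRV_le q c x : 0 < q -> 0 <= x -> 0 <= c ->
  (x `^ q^-1 <= c) = (x <= c `^ q).
Proof.
by move=> q0 x0 c0; rewrite -[in RHS](powRK q0 x0) ler_powR2r // powR_ge0.
Qed.

Lemma powRV_ge q c x : 0 < q -> 0 <= x -> 0 <= c ->
  (c <= x `^ q^-1) = (c `^ q <= x).
Proof.
by move=> q0 x0 c0; rewrite -[in RHS](powRK q0 x0) ler_powR2r // powR_ge0.
Qed.

End PowerRoot.

Section Gamma.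
Context {R : realType}.
Variables (n : nat) (a p : nat -> R).
Hypothesis hn : (1 <= n)%N.
Hypothesis ha : forall i, (1 <= i <= n)%N -> 0 < a i.
Hypothesis hp : forall i, (1 <= i <= n)%N -> 0 <= p i.
Variable g : R.
Hypothesis g1 : 1 < g.
Local Notation q := (g / (g - 1)).
Local Notation B := (Bgamma a p g).
Local Notation r := (block_end n B).
Local Notation beta := (beta_crit n B).
Local Notation K := (nblocks n B).
Local Notation kappa := (g * ln 2).
Local Notation S j k := (\sum_(j <= i < k.+1) p i).
Local Notation A j k := (\sum_(j <= i < k.+1) a i `^ q).

Let g_gt0 : 0 < g.
Proof. exact: lt_trans g1. Qed.

Let q_gt0 : 0 < q.
Proof. by rewrite divr_gt0 // subr_gt0. Qed.

Let kappa_gt0 : 0 < kappa.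
Proof. by rewrite mulr_gt0 // ln_gt0 // ltr1n. Qed.

Let qV : (g - 1) / g = q^-1.
Proof. by rewrite invf_div. Qed.

Lemma weight_ge0 j k : (1 <= j)%N -> (k <= n)%N -> 0 <= S j k.
Proof.
by move=> j1 kn; rewrite big_nat; apply: sumr_ge0 => i hi; apply: hp; lia.
Qed.

Lemma weight_ge j k i : (1 <= j)%N -> (j <= i <= k)%N -> (k <= n)%N ->
  p i <= S j k.
Proof.
move=> j1 /andP[ji ik] kn; rewrite (@big_cat_nat _ _ _ i) //=; last by lia.
rewrite [X in _ <= _ + X]big_ltn ?ltnS //.
have h1 : 0 <= \sum_(j <= i0 < i) p i0.
  by rewrite big_nat; apply: sumr_ge0 => i0 hi; apply: hp; lia.
have h2 := weight_ge0 (isT : (1 <= i.+1)%N) kn.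
by rewrite addrCA ler_wpDr // addr_ge0.
Qed.

Lemma power_sum_ge j k i : (j <= i <= k)%N -> a i `^ q <= A j k.
Proof.
move=> /andP[ji ik]; rewrite (@big_cat_nat _ _ _ i) //=; last by lia.
rewrite [X in _ <= _ + X]big_ltn ?ltnS // addrCA ler_wpDr // addr_ge0 //;
  by apply: sumr_ge0 => i0 _; apply: powR_ge0.
Qed.

Lemma power_sum_gt0 j k : (1 <= j <= k)%N -> (k <= n)%N -> 0 < A j k.
Proof.
move=> jk kn; apply: (lt_le_trans _ (@power_sum_ge j k j _)).
  by rewrite powR_gt0 // ha //; lia.
by rewrite leqnn; lia.
Qed.

Lemma Bgamma_ge0 j k : 0 <= B j k.
Proof. exact: powR_ge0. Qed.

(** Cleared of its root and of its denominator, the comparison of [Bgamma] with a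
    constant becomes additive in the interval of levels; this is what makes
    mediant arguments possible. *)
Lemma Bgamma_le c j k : (1 <= j <= k)%N -> (k <= n)%N -> 0 <= c ->
  (B j k <= c) = (kappa * S j k <= c `^ q * A j k).
Proof.
move=> jk kn c0; have A0 := power_sum_gt0 jk kn.
have S0 : 0 <= S j k by apply: weight_ge0 => //; lia.
rewrite /Bgamma qV -(mulrA _ g) (mulrC _ kappa) powRV_le ?ler_pdivrMr //.
exact: divr_ge0 (mulr_ge0 (ltW kappa_gt0) S0) (ltW A0).
Qed.

Lemma Bgamma_ge c j k : (1 <= j <= k)%N -> (k <= n)%N -> 0 <= c ->
  (c <= B j k) = (c `^ q * A j k <= kappa * S j k).
Proof.
move=> jk kn c0; have A0 := power_sum_gt0 jk kn.
have S0 : 0 <= S j k by apply: weight_ge0 => //; lia.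
rewrite /Bgamma qV -(mulrA _ g) (mulrC _ kappa) powRV_ge ?ler_pdivlMr //.
by rewrite mul0r; exact: mulr_ge0 (ltW kappa_gt0) S0.
Qed.

Lemma beta_gamma_ge0 l : 0 <= beta l.
Proof.
case: l => //= l; have [h|h] := ltnP (r l) n.
  by have [i _ <-] := block_min_attained B h; exact: Bgamma_ge0.
by rewrite /block_min big_geq // Bgamma_ge0.
Qed.

Lemma block_stepP l : (1 <= l <= K)%N ->
  [/\ (r l.-1 < r l <= n)%N,
      kappa * S (r l.-1).+1 (r l) = beta l `^ q * A (r l.-1).+1 (r l),
      (forall k, (r l.-1 < k <= n)%N ->
         beta l `^ q * A (r l.-1).+1 k <= kappa * S (r l.-1).+1 k) &
      (forall k, (r l < k <= n)%N ->
         beta l `^ q * A (r l.-1).+1 k < kappa * S (r l.-1).+1 k)].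
Proof.
case: l => // l lK; have [h1 h2 h3] := block_end_step (block_end_lt lK).
have b0 := beta_gamma_ge0 l.+1; rewrite !succnK in h1 h2 h3 *.
split=> //.
- apply/eqP; rewrite eq_le -Bgamma_le -?Bgamma_ge ?h2 ?lexx //; lia.
- move=> k hk; rewrite -Bgamma_ge //; try lia.
  by apply: block_min_le.
- move=> k hk; rewrite ltNge -Bgamma_le //; try lia.
  by rewrite -ltNge h3.
Qed.

(** Otherwise, by the mediant inequality, the l-th block could be extended by the
    next one without a larger ratio, against the choice of the largest minimizer. *)
Lemma beta_gamma_lt l : (0 < l < K)%N -> beta l < beta l.+1.
Proof.
move=> lK; have [|h1 e1 _ m1] := @block_stepP l; first by lia.
have [|h2 e2 _ _] := @block_stepP l.+1; first by lia.
rewrite succnK in h2 e2.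
rewrite ltNge; apply/negP => h.
have sp F : \sum_((r l.-1).+1 <= i < (r l.+1).+1) F i =
    \sum_((r l.-1).+1 <= i < (r l).+1) F i +
    \sum_((r l).+1 <= i < (r l.+1).+1) F i :> R.
  by apply: big_cat_nat; lia.
have := m1 (r l.+1) h2; rewrite !sp !mulrDr e1 ltrD2l e2 ltNge => /negP; apply.
by rewrite ler_wpM2r ?(ltW (power_sum_gt0 _ _)) ?ler_powR2r ?beta_gamma_ge0 //; lia.
Qed.

Lemma beta_gamma1_gt0 : 0 < p 1%N -> 0 < beta 1.
Proof.
move=> p1; have [|h e _ _] := @block_stepP 1; first by rewrite nblocks_gt0.
rewrite lt_neqAle beta_gamma_ge0 andbT; apply/eqP => b0.
have : 0 < kappa * S 1 (r 1).
  by rewrite mulr_gt0 // (lt_le_trans p1) //; apply: weight_ge; lia.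
by rewrite e -b0 powR0 ?mul0r ?ltxx // gt_eqF.
Qed.

Section Normalized.
Hypothesis hp1 : 0 < p 1%N.
Hypothesis hsum : S 1 n = 1.

Lemma weight_le1 j k : (1 <= j)%N -> (k <= n)%N -> S j k <= 1.
Proof.
move=> j1 kn; have [kj|jk] := ltnP k j; first by rewrite big_geq.
rewrite -hsum (@big_cat_nat _ _ _ j 1 n.+1) //=; last by lia.
rewrite (@big_cat_nat _ _ _ k.+1 j n.+1) //=; last by lia.
have h1 : 0 <= \sum_(1 <= i < j) p i.
  by rewrite big_nat; apply: sumr_ge0 => i hi; apply: hp; lia.
have h2 : 0 <= \sum_(k.+1 <= i < n.+1) p i.
  by rewrite big_nat; apply: sumr_ge0 => i hi; apply: hp; lia.
by rewrite addrCA ler_wpDr // addr_ge0.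
Qed.

Lemma beta_gamma_gt0 l : (1 <= l <= K)%N -> 0 < beta l.
Proof. exact: (beta_crit_gt0 beta_gamma_lt (beta_gamma1_gt0 hp1)). Qed.

(** The minimum that defines beta_l is at most the ratio at an index k >= i with
    a_k maximal, where the numerator is at most kappa and the denominator at least
    the power of a_k. *)
Lemma beta_gamma_le l i : (1 <= l <= K)%N -> ((r l.-1).+1 <= i < (r l).+1)%N ->
  beta l <= kappa `^ q^-1 / tail_max n a i.
Proof.
move=> hl hi; have hin := in_block_bounds hi.
have [k hk ak] : exists2 k, (i <= k <= n)%N & a k = tail_max n a i.
  by apply: tail_max_attained; case/andP: hin.
have [_ _ m _] := block_stepP hl.
have b0 := beta_gamma_ge0 l.
have /m h : (r l.-1 < k <= n)%N by lia.
have M0 : 0 < tail_max n a i by apply: tail_max_gt0.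
rewrite ler_pdivlMr // powRV_ge ?(mulr_ge0 b0 (ltW M0)) ?(ltW kappa_gt0) //.
rewrite powRM ?(ltW M0) // -ak.
apply: (le_trans (ler_wpM2l (powR_ge0 _ _) (@power_sum_ge (r l.-1).+1 k k _))).
  by lia.
apply: (le_trans h); rewrite ler_piMr ?(ltW kappa_gt0) // weight_le1 //; lia.
Qed.

(** The mediant inequality: as the block could have ended at i - 1, its part from
    i on has a ratio at most that of the whole block. That ratio is bounded below
    by keeping p_i only in the numerator. *)
Lemma beta_gamma_ge l i : (1 <= l <= K)%N -> ((r l.-1).+1 <= i < (r l).+1)%N ->
  (p i * kappa / n%:R) `^ q^-1 / tail_max n a i <= beta l.
Proof.
move=> hl hi; have hin := in_block_bounds hi.
have [h e m _] := block_stepP hl.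
have b0 := beta_gamma_ge0 l.
have M0 : 0 < tail_max n a i by apply: tail_max_gt0.
have n0 : 0 < n%:R :> R by rewrite ltr0n; lia.
have tail : kappa * S i (r l) <= beta l `^ q * A i (r l).
  have sp F : \sum_((r l.-1).+1 <= k < (r l).+1) F k =
      \sum_((r l.-1).+1 <= k < i) F k + \sum_(i <= k < (r l).+1) F k :> R.
    by apply: big_cat_nat; lia.
  have := e; rewrite !sp !mulrDr => e'.
  suff : beta l `^ q * (\sum_((r l.-1).+1 <= i0 < i) a i0 `^ q) <=
      kappa * (\sum_((r l.-1).+1 <= i0 < i) p i0).
    by move=> h'; rewrite -(lerD2l (kappa * \sum_((r l.-1).+1 <= i0 < i) p i0)) e' lerD2r.
  have [ei|ni] := eqVneq i (r l.-1).+1.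
    by rewrite ei !big_geq // !mulr0.
  have /m : (r l.-1 < i.-1 <= n)%N by lia.
  by rewrite prednK //; lia.
rewrite ler_pdivrMr // powRV_le ?(mulr_ge0 b0 (ltW M0)) //; last first.
  exact: divr_ge0 (mulr_ge0 (hp hin) (ltW kappa_gt0)) (ltW n0).
rewrite powRM ?(ltW M0) // ler_pdivrMr // -[leRHS]mulrA [p i * _]mulrC.
have w : p i <= S i (r l) by apply: weight_ge => //; lia.
apply: (le_trans (ler_wpM2l (ltW kappa_gt0) w)); apply: (le_trans tail).
rewrite ler_wpM2l ?powR_ge0 //.
apply: (@le_trans _ _ (\sum_(i <= k < (r l).+1) tail_max n a i `^ q)).
  rewrite big_nat [leRHS]big_nat; apply: ler_sum => k hk.
  rewrite ler_powR2r ?(ltW M0) //; last by apply/ltW/ha; lia.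
  by apply: tail_max_ge; lia.
rewrite big_const_nat iter_addr addr0 -[leLHS]mulr_natr ler_wpM2l ?powR_ge0 // ler_nat.
lia.
Qed.


(** The defining equation of beta_l turns the sum of powers over a block with
    beta_l < b into g log 2 times its weight over beta_l. The error e is the middle
    sum of the formula, at most (g - 1) log 2 because b does not exceed the ratio
    of the whole remaining interval of levels. *)
Lemma free_energy_gammaE b : 0 < b -> exists e,
  [/\ 0 <= e, e <= (g - 1) * ln 2,
      ln 2 * block_functional n B p b <= free_energy_gamma n a p g b - e &
      free_energy_gamma n a p g b - e <= g * ln 2 * block_functional n B p b].
Proof.
move=> b0.
have [] := beta_crit_selectlt beta_gamma_lt b0.
rewrite /free_energy_gamma (gt_eqF b0).
set j := head _ _ => jK lo hi.
rewrite (@block_functionalE _ _ _ _ _ j) //; last 2 first.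
- exact: beta_gamma_gt0.
- by move=> l /lo/ltW.
set X := \sum_((r j).+1 <= i < n.+1) p i.
set Y := \sum_(1 <= l < j.+1) (b / beta l * _).
exists ((g - 1) / g * \sum_((r j).+1 <= i < n.+1) (b * a i) `^ q).
have g10 : 0 <= g - 1 by rewrite subr_ge0 ltW.
have X0 : 0 <= X by apply: weight_ge0.
have Y0 : 0 <= Y.
  rewrite /Y big_nat; apply: sumr_ge0 => l hl.
  rewrite mulr_ge0 ?divr_ge0 ?beta_gamma_ge0 ?(ltW b0) //.
  by apply: weight_ge0 => //; apply: block_end_le.
have l2 : 0 < ln 2 :> R by rewrite ln_gt0 // ltr1n.
have -> : b * \sum_(1 <= l < j.+1) (beta l `^ (g - 1)^-1 *
    \sum_((r l.-1).+1 <= i < (r l).+1) a i `^ q) = kappa * Y.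
  rewrite /Y !mulr_sumr; apply: eq_big_nat => l hl.
  have hl' : (1 <= l <= K)%N by lia.
  have bl := beta_gamma_gt0 hl'; have [_ e _ _] := block_stepP hl'.
  have qe : (g - 1)^-1 = q - 1 by field; rewrite subr_eq0 gt_eqF.
  rewrite [X in beta l `^ X]qe.
  rewrite powRB ?(gt_eqF bl) ?implybT // powRr1 ?(ltW bl) //.
  by rewrite [_ / _ * _]mulrAC -e; field; rewrite gt_eqF.
rewrite -mulr_suml -/X.
set e := (g - 1) / g * _.
have -> : X * ln 2 + e + kappa * Y - e = ln 2 * (X + g * Y) by ring.
split.
- rewrite /e mulr_ge0 ?divr_ge0 ?(ltW g_gt0) //.
  by apply: sumr_ge0 => i _; apply: powR_ge0.
- suff : \sum_((r j).+1 <= i < n.+1) (b * a i) `^ q <= kappa.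
    move=> h; rewrite /e -mulrA ler_wpM2l // ler_pdivrMl //.
  have -> : \sum_((r j).+1 <= i < n.+1) (b * a i) `^ q = b `^ q * A (r j).+1 n.
    rewrite mulr_sumr; apply: eq_big_nat => i hij.
    by rewrite powRM ?(ltW b0) // ltW // ha //; lia.
  have [->|jnK] := eqVneq j K.
    by rewrite (nblocksP n B).1 [A _ _]big_geq // mulr0 ltW.
  have hj : (1 <= j.+1 <= K)%N by lia.
  have [hr _ m _] := block_stepP hj; rewrite succnK in hr m.
  have /m h : (r j < n <= n)%N by lia.
  apply: (@le_trans _ _ (beta j.+1 `^ q * A (r j).+1 n)).
    rewrite ler_wpM2r //; first by apply: sumr_ge0 => i _; apply: powR_ge0.
    by rewrite ler_powR2r ?beta_gamma_ge0 ?(ltW b0) // hi // ltnSn; lia.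
  by apply: (le_trans h); rewrite ler_piMr ?(ltW kappa_gt0) // weight_le1.
- by rewrite ler_wpM2l ?(ltW l2) // lerD2l ler_peMl // ltW.
- rewrite [leRHS]mulrAC [leRHS]mulrC ler_wpM2l ?(ltW l2) //.
  by rewrite mulrDr lerD2r ler_peMl // ltW.
Qed.

Definition lower_slope i := tail_max n a i / kappa `^ q^-1.
Definition upper_slope i := tail_max n a i * (n%:R / (p i * kappa)) `^ q^-1.

Lemma free_energy_gamma_lower b : 0 <= b ->
  ln 2 * zero_temperature_energy n p lower_slope b <= free_energy_gamma n a p g b.
Proof.
rewrite le_eqVlt => /predU1P[<-|b0].
  rewrite /zero_temperature_energy /free_energy_gamma eqxx.
  under eq_bigr do rewrite mul0r max_l ?ler01 // mulr1.
  by rewrite hsum mulr1.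
have [e [e0 _ h _]] := free_energy_gammaE b0.
apply: (@le_trans _ _ (free_energy_gamma n a p g b - e)); last by rewrite gerBl.
apply: le_trans h; rewrite ler_wpM2l ?ln_ge0 ?ler1n //.
apply: block_functional_ge => l i hl hi.
have hin := in_block_bounds hi.
rewrite ler_wpM2l ?hp //; apply: le_max2 => //; rewrite ler_wpM2l ?(ltW b0) //.
have M0 : 0 < tail_max n a i by apply: tail_max_gt0.
have k0 : 0 < kappa `^ q^-1 by apply: powR_gt0.
rewrite -[leLHS]invrK lef_pV2 ?posrE ?invr_gt0 ?divr_gt0 ?beta_gamma_gt0 //.
by rewrite invf_div beta_gamma_le.
Qed.

Lemma free_energy_gamma_upper b : 0 <= b ->
  free_energy_gamma n a p g b <=
  g * ln 2 * zero_temperature_energy n p upper_slope b + (g - 1) * ln 2.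
Proof.
rewrite le_eqVlt => /predU1P[<-|b0].
  rewrite /zero_temperature_energy /free_energy_gamma eqxx.
  under eq_bigr do rewrite mul0r max_l ?ler01 // mulr1.
  rewrite hsum mulr1 -mulrDl ler_peMl ?ln_ge0 ?ler1n //.
  by rewrite addrA lerBrDr lerD // ltW.
have [e [_ e1 _ h]] := free_energy_gammaE b0.
rewrite -(subrK e (free_energy_gamma _ _ _ _ _)) lerD //.
apply: (le_trans h); rewrite ler_wpM2l ?(ltW kappa_gt0) //.
apply: block_functional_le => l i hl hi.
have hin := in_block_bounds hi.
have := hp hin; rewrite le_eqVlt => /predU1P[<-|pi0]; first by rewrite !mul0r.
rewrite ler_wpM2l ?(ltW pi0) //; apply: le_max2 => //; rewrite ler_wpM2l ?(ltW b0) //.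
have M0 : 0 < tail_max n a i by apply: tail_max_gt0.
have n0 : 0 < n%:R :> R by rewrite ltr0n; lia.
have k0 : 0 < (n%:R / (p i * kappa)) `^ q^-1.
  by apply: powR_gt0; rewrite divr_gt0 // mulr_gt0.
rewrite -[leRHS]invrK lef_pV2 ?posrE ?invr_gt0 ?mulr_gt0 ?beta_gamma_gt0 //.
apply: le_trans (beta_gamma_ge hl hi).
rewrite /upper_slope.
have -> : (n%:R / (p i * kappa)) `^ q^-1 = ((p i * kappa / n%:R) `^ q^-1)^-1.
  have h0 : 0 <= p i * kappa / n%:R.
    exact: divr_ge0 (mulr_ge0 (ltW pi0) (ltW kappa_gt0)) (ltW n0).
  rewrite -[n%:R / _]invf_div -(powR_inv1 h0) powRAC powR_inv1 ?powR_ge0 //.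
by rewrite invfM invrK mulrC.
Qed.

End Normalized.
End Gamma.
(** * The limit of the formulas *)

Section Limit.
Context {R : realType}.
Variables (n : nat) (a p : nat -> R).
Hypothesis hn : (1 <= n)%N.
Hypothesis ha : forall i, (1 <= i <= n)%N -> 0 < a i.
Hypothesis hp : forall i, (1 <= i <= n)%N -> 0 <= p i.
Hypothesis hp1 : 0 < p 1%N.
Hypothesis hsum : \sum_(1 <= i < n.+1) p i = 1.

Lemma zero_temperature_energy_cvg (M : R -> nat -> R) (M0 : nat -> R)
    (F : set_system R) (b : R) : Filter F ->
  (forall i, (1 <= i <= n)%N -> 0 < p i -> M g i @[g --> F] --> M0 i) ->
  zero_temperature_energy n p (M g) b @[g --> F]
    --> zero_temperature_energy n p M0 b.
Proof.
move=> FF hM; rewrite /zero_temperature_energy big_nat.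
under eq_fun do rewrite big_nat.
apply: cvg_big => [|i hi]; first by move=> x; apply: add_continuous.
have := hp hi; rewrite le_eqVlt => /predU1P[<-|pi0].
  rewrite mul0r; under eq_fun do rewrite mul0r.
  exact: cvg_cst.
rewrite maxr_absE; under eq_fun do rewrite maxr_absE.
apply: cvgMl_tmp; apply: cvgMr_tmp; have h : b * M g i @[g --> F] --> b * M0 i by apply: cvgMl_tmp; exact: hM.
apply: cvgD; first by apply: cvgD => //; exact: cvg_cst.
by apply: cvg_norm; apply: cvgB => //; exact: cvg_cst.
Qed.

Lemma cvg_powR_exponent0 (f h : R -> R) (F : set_system R) (x : R) : Filter F ->
  0 < x -> f g @[g --> F] --> x -> h g @[g --> F] --> (0 : R) ->
  f g `^ h g @[g --> F] --> (1 : R).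
Proof.
move=> FF x0 fx h0.
have : expR (h g * ln (f g)) @[g --> F] --> expR (0 * ln x).
  apply: continuous_cvg; first exact: continuous_expR.
  by apply: cvgM => //; apply: continuous_cvg fx; exact: continuous_ln.
rewrite mul0r expR0; apply: cvg_trans; apply: near_eq_cvg.
near=> g; rewrite /powR gt_eqF //; near: g.
exact: (cvgr_gt x).
Unshelve. all: by end_near. Qed.

Lemma free_energy_gamma_cvg b : 0 <= b ->
  free_energy_gamma n a p g b @[g --> 1^'+] --> free_energy_exp n a p b.
Proof.
move=> b0; rewrite free_energy_expE //.
have g1 : g @[g --> (1:R)^'+] --> (1:R) by apply: cvg_at_right_filter; exact: cvg_id.
have gm1 : (g - 1) @[g --> (1:R)^'+] --> (0:R).
  by rewrite -(subrr 1); apply: cvgB => //; exact: cvg_cst.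
have l2 : 0 < ln 2 :> R by rewrite ln_gt0 // ltr1n.
have k1 : (g * ln 2) @[g --> (1:R)^'+] --> (ln 2 : R).
  by rewrite -[X in _ --> X]mul1r; apply: cvgMr_tmp.
have q0 : (g / (g - 1))^-1 @[g --> (1:R)^'+] --> (0:R).
  under eq_fun do rewrite invf_div.
  rewrite -(mul0r (1^-1)); apply: cvgM => //.
  by apply: cvgV => //; rewrite oner_eq0.
apply: (@squeeze_cvgr _ _ _ _
  (fun g => ln 2 * zero_temperature_energy n p (lower_slope n a g) b)
  (fun g => g * ln 2 * zero_temperature_energy n p (upper_slope n a p g) b
     + (g - 1) * ln 2)).
- near=> g; have lg : 1 < g by near: g; exact: nbhs_right_gt.
  by rewrite free_energy_gamma_lower ?free_energy_gamma_upper.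
- apply: cvgMl_tmp; apply: zero_temperature_energy_cvg => i hi pi0.
  rewrite /lower_slope; suff : tail_max n a i / (g * ln 2) `^ (g / (g - 1))^-1
      @[g --> 1^'+] --> tail_max n a i * 1^-1 by rewrite invr1 mulr1.
  apply: cvgMl_tmp; apply: cvgV; first by rewrite oner_eq0.
  exact: (cvg_powR_exponent0 _ l2).
- rewrite -[ln 2 * _]addr0 -(mul0r (ln 2)).
  apply: cvgD; last exact: cvgMr_tmp.
  apply: cvgM => //; apply: zero_temperature_energy_cvg => i hi pi0.
  suff : upper_slope n a p g i @[g --> 1^'+] --> tail_max n a i * 1.
    by rewrite mulr1.
  apply: cvgMl_tmp.
  have n0 : 0 < n%:R :> R by rewrite ltr0n.
  apply: (@cvg_powR_exponent0 _ _ _ (n%:R / (p i * ln 2))) => //.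
    by rewrite divr_gt0 // mulr_gt0.
  apply: cvgMl_tmp; apply: cvgV; first by rewrite gt_eqF // mulr_gt0.
  exact: cvgMl_tmp.
Unshelve. all: by end_near. Qed.

End Limit.
(** * The driving densities and their tails *)

Section Density.
Context {R : realType}.
Local Notation mu := (@lebesgue_measure R).
Variables (N : nat) (g : R).
Hypothesis N1 : (1 <= N)%N.
Hypothesis g1 : 1 <= g.

(** The density is split into a constant and a weight: the constant is controlled
    through the total mass 1, which avoids any computation with the Gamma
    function. *)
Definition phi_weight (x : R) : R :=
  expR (- (`|x| `^ g / (g * N%:R `^ (g - 1)))).

Definition phi_norm : R := (2 * Euler_Gamma g^-1)^-1 * (g / N%:R) `^ ((g - 1) / g).

Lemma phiE x : phi N g x = phi_norm * phi_weight x.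
Proof. by []. Qed.

Lemma phi_norm_ge0 : 0 <= phi_norm.
Proof.
rewrite mulr_ge0 ?powR_ge0 // invr_ge0 mulr_ge0 //.
by apply: Rintegral_ge0 => x _; rewrite mulr_ge0 ?powR_ge0 ?expR_ge0.
Qed.

Lemma measurable_phi_weight D : measurable_fun D phi_weight.
Proof.
apply: measurable_funTS; apply: measurableT_comp => //.
apply: measurableT_comp => //; apply: measurable_funM => //.
apply: (measurableT_comp (measurable_powR _)).
exact: normr_measurable.
Qed.

Lemma measurable_phi D : measurable_fun D (phi N g).
Proof.
by apply: measurable_funM => //; exact: measurable_phi_weight.
Qed.

Lemma measurable_EFin_phi D : measurable_fun D (fun x => (phi N g x)%:E).
Proof. by apply/measurable_EFinP; exact: measurable_phi. Qed.

Lemma phi_ge0 x : 0 <= phi N g x.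
Proof. by rewrite phiE mulr_ge0 ?phi_norm_ge0 ?expR_ge0. Qed.

Lemma phiN x : phi N g (- x) = phi N g x.
Proof. by rewrite /phi normrN. Qed.

Hypothesis phi1 : (\int[mu]_x (phi N g x)%:E = 1)%E.

Definition survival (t : R) : R := fine (\int[mu]_(x in `]t, +oo[) (phi N g x)%:E)%E.

Lemma survivalE t : (\int[mu]_(x in `]t, +oo[) (phi N g x)%:E = (survival t)%:E)%E.
Proof.
rewrite /survival fineK // ge0_fin_numE; last first.
  by apply: integral_ge0 => x _; rewrite lee_fin phi_ge0.
apply: (@le_lt_trans _ _ 1%E); last by rewrite ltry.
rewrite -phi1; apply: ge0_subset_integral => //.
- exact: measurable_EFin_phi.
- by move=> x _; rewrite lee_fin phi_ge0.
Qed.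

Lemma survival_noninc t u : t <= u -> survival u <= survival t.
Proof.
move=> tu; rewrite -lee_fin -!survivalE; apply: ge0_subset_integral => //.
- exact: measurable_EFin_phi.
- by move=> x _; rewrite lee_fin phi_ge0.
- by apply: subset_itvr; rewrite bnd_simp.
Qed.

Lemma survivalC t :
  (\int[mu]_(x in `]-oo, t]) (phi N g x)%:E = (1 - survival t)%:E)%E.
Proof.
have := phi1; rewrite -(setUv `]-oo, t]) ge0_integral_setU //=; last 4 first.
- exact: measurableC.
- exact: measurable_EFin_phi.
- by move=> x _; rewrite lee_fin phi_ge0.
- exact/disj_setPCl.
rewrite setCitvl survivalE => h.
by rewrite EFinB -h addeK.
Qed.

(** The density is even, and so is Lebesgue measure. *)
Lemma survivalN t : survival (- t) = 1 - survival t.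
Proof.
apply: EFin_inj; rewrite -survivalC -survivalE.
have -> : `]-oo, t]%classic = (-%R : _ -> measurableTypeR R) @^-1` `[- t, +oo[.
  by rewrite opp_preimage_itvbndy opprK.
pose f := fun x : R => (phi N g x)%:E.
transitivity (\int[mu]_(x in (-%R : _ -> measurableTypeR R) @^-1` `[(- t)%R, +oo[)
    (f \o (-%R : _ -> measurableTypeR R)) x)%E.
  2: by apply: eq_integral => x _; rewrite /f /= phiN.
rewrite -ge0_integral_pushforward //=.
- rewrite integral_itv_obnd_cbnd; last exact: measurable_EFin_phi.
  by apply: eq_measure_integral => //= A mA AS; exact/esym/lebesgue_measureN.
- exact: measurable_EFin_phi.
- by move=> x _; rewrite /f lee_fin phi_ge0.
Qed.

Lemma survival0 : survival 0 = 2^-1.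
Proof. by have := survivalN 0; rewrite oppr0; lra. Qed.

End Density.
Section Tails.
Context {R : realType}.
Local Notation mu := (@lebesgue_measure R).

Lemma integral_expRN (t : R) :
  (\int[mu]_(x in `]t, +oo[) (expR (- x))%:E = (expR (- t))%:E)%E.
Proof.
have ce : continuous (fun z : R^o => expR (- z)).
  move=> z; apply: continuous_comp; last exact: continuous_expR.
  exact: (@continuousN _ R^o).
rewrite integral_itv_obnd_cbnd; last first.
  apply/measurable_EFinP; apply: measurable_funTS.
  exact: (@continuous_measurable_fun R).
rewrite (@ge0_continuous_FTC2y _ _ (fun x => - expR (- x)) _ 0) //.
- by rewrite EFinN oppeK add0e.
- exact: continuous_subspaceT.
- by rewrite -oppr0; apply: cvgN; exact: cvgr_expR.
- by apply: cvgN; apply/cvg_at_right_filter; exact: ce.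
- move=> z _; rewrite derive1_comp // derive1N // derive1_id mulN1r.
  rewrite derive1_comp // derive1E.
  have /funeqP -> := @derive_expR R.
  by rewrite derive1N // derive1_id mulrN1 opprK.
Qed.

Section Rate.
Variables (N : nat) (g : R).
Hypothesis N1 : (1 <= N)%N.
Hypothesis g1 : 1 <= g.

Definition rate (x : R) : R := x `^ g / (g * N%:R `^ (g - 1)).

Let g0 : 0 < g.
Proof. exact: lt_le_trans g1. Qed.

Let N0 : 0 < N%:R :> R.
Proof. by rewrite ltr0n. Qed.

(** Young's inequality for x / N and 1: the tangent of y^g / g at y = 1 has slope
    1, so that the weight is dominated by a multiple of the exponential. *)
Lemma rate_ge x : 0 <= x -> x - N%:R * ((g - 1) / g) <= rate x.
Proof.
move=> x0; rewrite /rate.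
move: g1; rewrite le_eqVlt => /predU1P[<-|lg].
  by rewrite subrr powRr0 powRr1 // mul0r mulr0 subr0 mulr1 divr1.
have := @conjugate_powR R (x / N%:R) 1 g (g / (g - 1)) _ _ _ _ _.
rewrite powR1 mulr1 invf_div mul1r => h.
have {}h : x / N%:R <= (x / N%:R) `^ g / g + (g - 1) / g.
  apply: h => //; rewrite ?divr_ge0 // ?divr_gt0 // ?subr_gt0 //; try exact: ltW.
  by field; rewrite gt_eqF.
have -> : x `^ g / (g * N%:R `^ (g - 1)) = N%:R * ((x / N%:R) `^ g / g).
  rewrite powRM ?invr_ge0 ?(ltW N0) // -[N%:R^-1]powR_inv1 ?(ltW N0) //.
  rewrite -powRrM mulN1r powRN -(@mulr_powRB1 _ N%:R g) ?(ltW N0) //.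
  by field; rewrite !gt_eqF // powR_gt0.
by rewrite lerBlDr -mulrDr -ler_pdivrMl // mulrC.
Qed.

Lemma rate_le (M x : R) : 0 <= x <= M * N%:R -> rate x <= x * M `^ (g - 1).
Proof.
move=> /andP[x0 xM].
have M0 : 0 <= M by rewrite -(pmulr_lge0 _ N0) (le_trans x0).
have P0 : 0 < N%:R `^ (g - 1) by apply: powR_gt0.
rewrite /rate ler_pdivrMr ?mulr_gt0 // -(mulr_powRB1 x0 g0) -mulrA ler_wpM2l //.
rewrite mulrCA -powRM ?(ltW N0) //.
apply: (@le_trans _ _ ((M * N%:R) `^ (g - 1))).
  by apply: ge0_ler_powR; rewrite ?nnegrE ?subr_ge0 // (le_trans x0).
by rewrite ler_peMl ?powR_ge0.
Qed.

Lemma rate_g1 x : 0 <= x -> g = 1 -> rate x = x.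
Proof. by move=> x0 ge; rewrite /rate ge subrr powRr0 powRr1 // mulr1 divr1. Qed.

Lemma phi_weightE x : 0 <= x -> phi_weight N g x = expR (- rate x).
Proof. by move=> x0; rewrite /phi_weight ger0_norm. Qed.

Hypothesis phi1 : (\int[mu]_x (phi N g x)%:E = 1)%E.

Local Notation C := (phi_norm N g).
Local Notation S := (survival N g).
Local Notation excess := (N%:R * ((g - 1) / g)).

Lemma survival_weight t :
  ((S t)%:E = C%:E * \int[mu]_(x in `]t, +oo[) (phi_weight N g x)%:E)%E.
Proof.
rewrite -survivalE // -ge0_integralZl //.
- by apply/measurable_EFinP; exact: measurable_phi_weight.
- by move=> x _; rewrite lee_fin expR_ge0.
- by rewrite lee_fin phi_norm_ge0.
Qed.

Lemma survival_le t : 0 <= t -> S t <= C * (expR excess * expR (- t)).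
Proof.
move=> t0; rewrite -lee_fin survival_weight [leRHS]EFinM.
apply: lee_wpmul2l; first by rewrite lee_fin phi_norm_ge0.
have me : measurable_fun `]t, +oo[ (fun x : R => (expR (- x))%:E).
  apply/measurable_EFinP; apply: measurable_funTS.
  by apply: measurableT_comp => //.
rewrite [leRHS]EFinM -integral_expRN -ge0_integralZl //.
apply: ge0_le_integral => //.
- by move=> x _; rewrite lee_fin expR_ge0.
- by apply/measurable_EFinP; exact: measurable_phi_weight.
- exact: emeasurable_funM.
move=> x; rewrite /= in_itv /= andbT => tx.
have x0 : 0 <= x by rewrite (le_trans t0) // ltW.
rewrite -EFinM lee_fin phi_weightE // -expRD ler_expR.
by have := rate_ge x0; lra.
Qed.

Lemma survival_ge (M t : R) : 0 <= t -> t + 1 <= M * N%:R ->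
  C * expR (- ((t + 1) * M `^ (g - 1))) <= S t.
Proof.
move=> t0 tM; rewrite -lee_fin survival_weight [leLHS]EFinM.
apply: lee_wpmul2l; first by rewrite lee_fin phi_norm_ge0.
set c := expR _.
have -> : c%:E = (\int[mu]_(x in `]t, (t + 1)%R]) (cst c%:E) x)%E.
  rewrite integral_cst //= lebesgue_measure_itv /= lte_fin ltrDl ltr01.
  by rewrite -EFinB -EFinM addrAC subrr add0r mulr1.
apply: (@le_trans _ _ (\int[mu]_(x in `]t, (t + 1)%R]) (phi_weight N g x)%:E)%E).
  apply: ge0_le_integral => //.
  - by move=> x _; rewrite lee_fin expR_ge0.
  - by apply/measurable_EFinP; exact: measurable_phi_weight.
  move=> x; rewrite /= in_itv /= => /andP[tx xt].
  have x0 : 0 <= x by rewrite (le_trans t0) // ltW.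
  rewrite lee_fin phi_weightE // ler_expR lerN2.
  apply: (@le_trans _ _ (x * M `^ (g - 1))).
    by apply: rate_le; rewrite x0 (le_trans xt).
  by rewrite ler_wpM2r ?powR_ge0.
apply: ge0_subset_integral => //.
- by apply/measurable_EFinP; exact: measurable_phi_weight.
- by move=> x _; rewrite lee_fin expR_ge0.
- by apply: subset_itvl; rewrite bnd_simp.
Qed.

(** Half of the mass lies to the right of 0; the bounds for the tail at 0 thus
    enclose the constant, here and in the next lemma. *)
Lemma phi_norm_le : C <= expR 1 / 2.
Proof.
have h : 0 + 1 <= 1 * N%:R :> R by rewrite add0r mul1r ler1n.
have := survival_ge (lexx _) h.
rewrite add0r !mul1r powR1 survival0 // expRN => {}h.
by move: h; rewrite ler_pdivrMr ?expR_gt0 // mulrC.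
Qed.

Lemma phi_norm_ge : expR (- excess) / 2 <= C.
Proof.
have := @survival_le 0 (lexx _).
rewrite oppr0 expR0 mulr1 survival0 // => h.
by rewrite expRN mulrC ler_pdivrMr ?expR_gt0.
Qed.

End Rate.
End Tails.
(** * Transport to the exponential law *)

Section Quantile.
Context {R : realType}.
Local Notation mu := (@lebesgue_measure R).

(** The inverse of the survival function of the two-sided exponential law. *)
Definition laplace_quantile (s : R) : R :=
  if s <= 2^-1 then - ln (2 * s) else ln (2 * (1 - s)).

Lemma laplace_quantileC s : laplace_quantile (1 - s) = - laplace_quantile s.
Proof.
rewrite /laplace_quantile subKr.
have [s1|s1|->] := ltgtP s 2^-1.
- by rewrite ifF ?opprK //; apply/negbTE; rewrite -ltNge; lra.
- by rewrite ifT //; lra.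
- have -> : 1 - 2^-1 = 2^-1 :> R by lra.
  by rewrite lexx mulfV // ln1 !oppr0.
Qed.

Lemma laplace_quantile_noninc s s' : 0 < s -> s <= s' -> s' < 1 ->
  laplace_quantile s' <= laplace_quantile s.
Proof.
move=> s0 ss s1; rewrite /laplace_quantile.
have [h|h] := leP s 2^-1; have [h'|h'] := leP s' 2^-1.
- by rewrite lerN2 ler_ln ?posrE; lra.
- apply: (@le_trans _ _ 0); first by rewrite ln_le0 //; lra.
  by rewrite oppr_ge0 ln_le0 //; lra.
- by lra.
- by rewrite ler_ln ?posrE; lra.
Qed.

Lemma survival_laplace N (t : R) : (1 <= N)%N ->
  (\int[mu]_x (phi N (1:R) x)%:E = 1)%E -> 0 <= t ->
  survival N 1 t = expR (- t) / 2.
Proof.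
move=> N1 phi1.
have w u : 0 <= u -> survival N 1 u = phi_norm N 1 * expR (- u) :> R.
  move=> u0; apply: EFin_inj; rewrite survival_weight // [RHS]EFinM.
  rewrite -integral_expRN; congr (_ * _)%E; apply: eq_integral => x.
  rewrite inE /= in_itv /= andbT => ux.
  have x0 : 0 <= x by rewrite (le_trans u0) // ltW.
  by rewrite phi_weightE // rate_g1.
move=> t0; rewrite w //; have := w 0 (lexx _).
by rewrite survival0 // oppr0 expR0 mulr1 => <-; rewrite mulrC.
Qed.

Lemma survival_laplace_quantile N (s : R) : (1 <= N)%N ->
  (\int[mu]_x (phi N (1:R) x)%:E = 1)%E -> 0 < s < 1 ->
  survival N 1 (laplace_quantile s) = s.
Proof.
move=> N1 phi1 /andP[s0 s1].
have half u : 0 < u -> u <= 2^-1 -> survival N 1 (laplace_quantile u) = u.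
  move=> u0 u2; rewrite /laplace_quantile u2 survival_laplace //.
    by rewrite opprK lnK ?posrE; lra.
  by rewrite oppr_ge0 ln_le0 //; lra.
have [h|h] := leP s 2^-1; first exact: half.
have := half (1 - s); rewrite laplace_quantileC survivalN // => hs.
have h1 : 0 < 1 - s by lra.
have h2 : 1 - s <= 2^-1 by lra.
by have := hs h1 h2; lra.
Qed.

Lemma survival_bounds N (g t : R) : (1 <= N)%N -> 1 <= g ->
  (\int[mu]_x (phi N g x)%:E = 1)%E -> 0 < survival N g t < 1.
Proof.
move=> N1 g1 phi1.
have N0 : 0 < N%:R :> R by rewrite ltr0n.
have half u : 0 <= u -> 0 < survival N g u <= 2^-1.
  move=> u0; rewrite -(survival0 phi1) survival_noninc ?andbT //.
  have C0 : 0 < phi_norm N g by apply: lt_le_trans (phi_norm_ge N1 g1 phi1);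
    rewrite divr_gt0 ?expR_gt0.
  apply: (lt_le_trans _ (survival_ge N1 g1 phi1 u0 (M := (u + 1) / N%:R) _)).
    by rewrite mulr_gt0 ?expR_gt0.
  by rewrite divfK // gt_eqF.
have [t0|t0] := leP 0 t; first by have := half t t0; lra.
have /half : 0 <= - t by rewrite oppr_ge0 ltW.
by rewrite survivalN //; lra.
Qed.

(** On the positive axis the logarithm of twice the tail lies between
    - (t + 1) M^(g - 1) - N (g - 1) / g and - t + N (g - 1) / g + 1, and the
    transported point is its opposite; the negative axis follows by symmetry. *)
Lemma quantile_close N (g M t : R) : (1 <= N)%N -> 1 <= g ->
  (\int[mu]_x (phi N g x)%:E = 1)%E -> 1 <= M ->
  `|t| + 1 <= M * N%:R ->
  `|laplace_quantile (survival N g t) - t|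
    <= N%:R * ((g - 1) / g) + 1 + M * N%:R * (M `^ (g - 1) - 1).
Proof.
move=> N1 g1 phi1 M1.
have pos u : 0 <= u -> u + 1 <= M * N%:R ->
    `|laplace_quantile (survival N g u) - u|
    <= N%:R * ((g - 1) / g) + 1 + M * N%:R * (M `^ (g - 1) - 1).
  move=> u0 uM.
  have M'1 : 1 <= M `^ (g - 1).
    by rewrite -[leLHS](powRr0 M) ler_powR // subr_ge0.
  have g0 : 0 < g by exact: lt_le_trans g1.
  have e0 : 0 <= N%:R * ((g - 1) / g) by rewrite mulr_ge0 // divr_ge0 ?subr_ge0 // ltW.
  have s0 := survival_bounds u N1 g1 phi1.
  have s2 : survival N g u <= 2^-1.
    by rewrite -(survival0 phi1) survival_noninc.
  have lo := survival_ge N1 g1 phi1 u0 uM.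
  have hi := survival_le N1 g1 phi1 u0.
  have Clo := phi_norm_ge N1 g1 phi1.
  have Chi := phi_norm_le N1 g1 phi1.
  set s := survival N g u in s0 s2 lo hi *.
  set C := phi_norm N g in lo hi Clo Chi.
  set e := N%:R * _ in e0 hi Clo *; set M' := M `^ _ in M'1 lo *.
  have {lo} lo : - e - (u + 1) * M' <= ln (2 * s).
    rewrite -ler_expR lnK ?posrE; last by lra.
    rewrite expRD.
    have : expR (- e) / 2 * expR (- ((u + 1) * M')) <= C * expR (- ((u + 1) * M')).
      by rewrite ler_wpM2r ?expR_ge0.
    by lra.
  have {hi} hi : ln (2 * s) <= 1 + e - u.
    rewrite -ler_expR lnK ?posrE; last by lra.
    rewrite !expRD -mulrA.
    have : C * (expR e * expR (- u)) <= expR 1 / 2 * (expR e * expR (- u)).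
      by rewrite ler_wpM2r // mulr_ge0 ?expR_ge0.
    by lra.
  have h : 0 <= (M * N%:R - (u + 1)) * (M' - 1).
    by rewrite mulr_ge0 // subr_ge0.
  have h' : 0 <= M * N%:R * (M' - 1).
    by rewrite mulr_ge0 ?subr_ge0 // mulr_ge0 // (le_trans ler01).
  rewrite /laplace_quantile s2 ler_norml; apply/andP; split; last first.
    suff : (u + 1) * M' - u <= 1 + M * N%:R * (M' - 1) by lra.
    by lra.
  by lra.
have [t0|t0] := leP 0 t; first by rewrite ger0_norm //; exact: pos.
rewrite ltr0_norm // => tM; have := pos (- t); rewrite survivalN //.
rewrite laplace_quantileC -opprD normrN => -> //.
by rewrite oppr_ge0 ltW.
Qed.

End Quantile.
(** * Coupling by discretization *)

Section Coupling.
Context {R : realType}.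

(** For a nondecreasing theta this is the number of cut points theta 0, ...,
    theta (m - 1) to the left of x, hence the index of the cell of x. *)
Definition cell (m : nat) (theta : nat -> R) (x : R) : nat :=
  \max_(i < m | theta i < x) i.+1.

Lemma cell_gt m theta x j : {homo theta : i k / (i <= k)%N >-> i <= k} ->
  (j < m)%N -> (j < cell m theta x)%N = (theta j < x).
Proof.
move=> homo jm; apply/idP/idP => [|h]; last first.
  exact: (leq_bigmax_cond (Ordinal jm)).
apply: contraTT; rewrite -leNgt -leqNgt => xj.
apply/bigmax_leqP => i ix; rewrite ltnNge; apply/negP => ji.
by have := lt_le_trans ix xj; rewrite ltNge homo.
Qed.

Lemma cell_le m theta x : (cell m theta x <= m)%N.
Proof. by apply/bigmax_leqP => i _; exact: ltn_ord. Qed.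

Lemma preimage_cell_ge m theta j :
  {homo theta : i k / (i <= k)%N >-> i <= k} -> (j < m)%N ->
  [set x | (j < cell m theta x)%N] = `]theta j, +oo[%classic.
Proof.
move=> homo jm; apply/seteqP; split => x /=; rewrite in_itv /= andbT cell_gt //.
Qed.

(** The points of cell index at least j, in a form whose probability is a tail
    probability. *)
Definition cell_ge_set (m : nat) (theta : nat -> R) (j : nat) : set R :=
  if j is j'.+1 then (if (j' < m)%N then `]theta j', +oo[%classic else set0) else setT.

Lemma cell_preimage m theta j :
  {homo theta : i k / (i <= k)%N >-> i <= k} ->
  cell m theta @^-1` [set j] = cell_ge_set m theta j `\` cell_ge_set m theta j.+1.
Proof.
move=> homo.
have h i : cell_ge_set m theta i = [set x | (i <= cell m theta x)%N].
  case: i => [|i] /=; first by apply/seteqP; split.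
  case: ltnP => im; first by rewrite -(preimage_cell_ge homo im).
  apply/seteqP; split => // x /= h.
  by have := cell_le m theta x; rewrite leqNgt (leq_trans _ h).
rewrite !h; apply/seteqP; split => x /=.
  by move=> ->; rewrite ltnn.
by case=> h1 /negP; rewrite -leqNgt => h2; apply/eqP; rewrite eqn_leq h1 h2.
Qed.

Lemma measurable_cell_ge_set m theta j : measurable (cell_ge_set m theta j).
Proof. by case: j => //= j; case: ifP. Qed.

Lemma cell_law (mu1 mu2 : {measure set R -> \bar R}) m theta1 theta2 j :
  {homo theta1 : i k / (i <= k)%N >-> i <= k} ->
  {homo theta2 : i k / (i <= k)%N >-> i <= k} ->
  mu1 setT = mu2 setT -> (mu1 setT < +oo)%E ->
  (forall i, (i < m)%N -> mu1 `]theta1 i, +oo[%classic = mu2 `]theta2 i, +oo[%classic) ->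
  mu1 (cell m theta1 @^-1` [set j]) = mu2 (cell m theta2 @^-1` [set j]).
Proof.
move=> homo1 homo2 eT fin eI; rewrite !cell_preimage //.
have e i : mu1 (cell_ge_set m theta1 i) = mu2 (cell_ge_set m theta2 i).
  by case: i => //= i; case: ltnP => im; [exact: eI|rewrite !measure0].
have mI th i : {homo th : i k / (i <= k)%N >-> i <= k} ->
    cell_ge_set m th i `&` cell_ge_set m th i.+1 = cell_ge_set m th i.+1.
  move=> homo; apply: setIidr; case: i => //= i.
  case: (ltnP i.+1 m) => im //; rewrite ltnW //.
  by apply: subset_itvr; rewrite bnd_simp homo.
have fin1 i : (mu1 (cell_ge_set m theta1 i) < +oo)%E.
  by apply: le_lt_trans fin; apply: le_measure; rewrite ?inE //;
    exact: measurable_cell_ge_set.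
have fin2 i : (mu2 (cell_ge_set m theta2 i) < +oo)%E by rewrite -e.
have mc := measurable_cell_ge_set.
rewrite !measureD; [|exact: mc|exact: mc|exact: fin2|exact: mc|exact: mc|exact: fin1].
by rewrite !mI //; congr (_ - _)%E; exact: e.
Qed.

(** Let W be the set of vectors of cells that occur on E1. By independence W has
    the same probability on both sides, and it is at least P1 E1. If no vector of
    W occurred on E2, the sum of P1 E1 and P2 E2 would be at most 1. *)
Lemma coupling_by_cells d1 d2 (T1 : measurableType d1) (T2 : measurableType d2)
    (P1 : probability T1 R) (P2 : probability T2 R) (I : eqType) (A : set I)
    (X1 : I -> {RV P1 >-> R}) (X2 : I -> {RV P2 >-> R}) (s : seq I)
    (m : nat) (c1 c2 : R -> nat) (E1 : set T1) (E2 : set T2) :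
  mutually_independent A X1 -> mutually_independent A X2 ->
  uniq s -> (forall i, i \in s -> A i) ->
  (forall x, (c1 x <= m)%N) ->
  (forall j, measurable (c1 @^-1` [set j])) ->
  (forall j, measurable (c2 @^-1` [set j])) ->
  (forall i j, i \in s -> P1 (X1 i @^-1` (c1 @^-1` [set j])) =
                          P2 (X2 i @^-1` (c2 @^-1` [set j]))) ->
  measurable E1 -> measurable E2 -> (1 < P1 E1 + P2 E2)%E ->
  exists w1 w2, [/\ E1 w1, E2 w2 &
    forall i, i \in s -> c1 (X1 i w1) = c2 (X2 i w2)].
Proof.
move=> ind1 ind2 us sA c1m mc1 mc2 law mE1 mE2 big.
pose B (c : R -> nat) (f : (size s).-tuple 'I_m.+1) i : set R :=
  c @^-1` [set nat_of_ord (nth ord0 f (index i s))].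
pose F1 f := \bigcap_(i in [set` s]) (X1 i @^-1` B c1 f i).
pose F2 f := \bigcap_(i in [set` s]) (X2 i @^-1` B c2 f i).
have e12 f : P1 (F1 f) = P2 (F2 f).
  rewrite ind1 // ?ind2 //; try by move=> i; rewrite /B.
  by rewrite big_seq [RHS]big_seq; apply: eq_bigr => i si; exact: law.
have mF1 f : measurable (F1 f).
  apply: fin_bigcap_measurable => // i _.
  by rewrite -[X in measurable X]setTI; apply: measurable_funP => //; exact: mc1.
have mF2 f : measurable (F2 f).
  apply: fin_bigcap_measurable => // i _.
  by rewrite -[X in measurable X]setTI; apply: measurable_funP => //; exact: mc2.
have tF (f f' : (size s).-tuple 'I_m.+1) (g : I -> nat) : (forall i, i \in s -> g i = nth ord0 f (index i s)) ->
    (forall i, i \in s -> g i = nth ord0 f' (index i s)) -> f = f'.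
  move=> h h'; apply: eq_from_tnth => k.
  have ks : (k < size s)%N := ltn_ord k.
  have [x0 _] : exists x0 : I, true.
    by have := leq_ltn_trans (leq0n k) ks; case: (s) => // y t _; exists y.
  rewrite !(tnth_nth ord0); apply: val_inj => /=.
  have := h (nth x0 s k); rewrite mem_nth // => /(_ isT) e.
  have := h' (nth x0 s k); rewrite mem_nth // => /(_ isT) e'.
  by rewrite index_uniq // in e e'; rewrite -e -e'.
pose U : set ((size s).-tuple 'I_m.+1) := [set f | F1 f `&` E1 !=set0].
have fU : finite_set U by exact: finite_finset.
have [w2 [[f Uf F2f] E2w2]] : exists w2, (\bigcup_(f in U) F2 f) w2 /\ E2 w2.
  apply: contrapT => no.
  have mW1 : measurable (\bigcup_(f in U) F1 f).
    by apply: fin_bigcup_measurable.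
  have mW2 : measurable (\bigcup_(f in U) F2 f).
    by apply: fin_bigcup_measurable.
  have W12 : P1 (\bigcup_(f in U) F1 f) = P2 (\bigcup_(f in U) F2 f).
    rewrite !measure_fin_bigcup //.
    - by apply: eq_fsbigr => f _; exact: e12.
    - move=> f f' _ _ [w [h h']]; apply: (tF _ _ (fun i => c2 (X2 i w))).
      + by move=> i si; exact: h.
      + by move=> i si; exact: h'.
    - move=> f f' _ _ [w [h h']]; apply: (tF _ _ (fun i => c1 (X1 i w))).
      + by move=> i si; exact: h.
      + by move=> i si; exact: h'.
  have E1W : E1 `<=` \bigcup_(f in U) F1 f.
    move=> w Ew; pose f := [tuple of map (fun i => (inord (c1 (X1 i w)) : 'I_m.+1)) (in_tuple s)].
    have Ff : F1 f w.
      move=> i /= si; rewrite /B /= (nth_map i) ?index_mem // nth_index //.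
      by rewrite inordK // ltnS.
    by exists f => //; exists w.
  have : (P1 E1 + P2 E2 <= P2 (\bigcup_(f in U) F2 f `|` E2))%E.
    rewrite measureU //; last first.
      by apply/seteqP; split => // w [h1 h2]; apply: no; exists w.
    apply: leeD2r; apply: le_trans (_ : P1 (\bigcup_(f in U) F1 f) <= _)%E.
      by apply: le_measure; rewrite ?inE.
    by rewrite W12.
  move=> /(lt_le_trans big); rewrite ltNge => /negP; apply.
  by apply: probability_le1; exact: measurableU.
case: Uf => w1 [F1f E1w1]; exists w1, w2; split => // i si.
by rewrite (F1f i si) (F2f i si).
Qed.

End Coupling.
(** * The coupled disorders *)

Section Comparison.
Context {R : realType}.
Local Notation mu := (@lebesgue_measure R).

Lemma iid_density_integral d (T : measurableType d) (P : probability T R)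
    (I : eqType) (A : set I) (f : R -> R) (X : I -> {RV P >-> R}) i :
  iid_with_density A f X -> A i -> (\int[mu]_x (f x)%:E = 1)%E.
Proof.
move=> [_ h] Ai; rewrite -(h _ Ai) //; exact: (@probability_setT _ _ _ (distribution P (X i))).
Qed.

Lemma distribution_gt d (T : measurableType d) (P : probability T R)
    (I : eqType) (A : set I) (N : nat) (g : R) (X : I -> {RV P >-> R}) i t :
  iid_with_density A (phi N g) X -> 1 <= g -> A i ->
  distribution P (X i) `]t, +oo[%classic = (survival N g t)%:E.
Proof.
move=> h g1 Ai; have phi1 := iid_density_integral h Ai.
by rewrite (h.2 _ Ai) // survivalE.
Qed.

Lemma distribution_le d (T : measurableType d) (P : probability T R)
    (I : eqType) (A : set I) (N : nat) (g : R) (X : I -> {RV P >-> R}) i t :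
  iid_with_density A (phi N g) X -> 1 <= g -> A i ->
  distribution P (X i) `]-oo, t]%classic = (1 - survival N g t)%:E.
Proof.
move=> h g1 Ai; have phi1 := iid_density_integral h Ai.
by rewrite (h.2 _ Ai) // survivalC.
Qed.

Lemma union_bound d (T : measurableType d) (P : probability T R)
    (I : choiceType) (s : seq I) (F : I -> set T) (c : R) : uniq s ->
  (forall i, i \in s -> measurable (F i)) ->
  (forall i, i \in s -> (P (F i) <= c%:E)%E) ->
  (P (\bigcup_(i in [set` s]) F i) <= ((size s)%:R * c)%:E)%E.
Proof.
move=> us mF hF.
have mU : measurable (\bigcup_(i in [set` s]) F i).
  by apply: fin_bigcup_measurable => // i; exact: mF.
apply: (le_trans (@content_sub_fsum _ _ _ P _ [set` s] _ F _ _ mU _)) => //.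
rewrite -fsbig_seq //; apply: (@le_trans _ _ (\sum_(i <- s) c%:E)%E).
  by rewrite big_seq [leRHS]big_seq; apply: lee_sum.
by rewrite sumEFin big_const_seq count_predT iter_addr addr0 mulr_natl.
Qed.

Section Coupling.
Variables (N J : nat) (g : R).
Hypothesis N1 : (1 <= N)%N.
Hypothesis J1 : (1 <= J)%N.
Hypothesis g1 : 1 <= g.
Hypothesis phig : (\int[mu]_x (phi N g x)%:E = 1)%E.
Hypothesis phi1 : (\int[mu]_x (phi N (1:R) x)%:E = 1)%E.

(** The interval [-3N, 3N] is cut into 2 J pieces of equal length. *)
Definition grid (i : nat) : R := (i%:R / J%:R * 3 - 3) * N%:R.
Definition laplace_grid (i : nat) : R := laplace_quantile (survival N g (grid i)).
Definition quantile_error : R :=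
  N%:R * ((g - 1) / g) + 1 + 4 * N%:R * (4 `^ (g - 1) - 1).

Let N0 : 0 < N%:R :> R.
Proof. by rewrite ltr0n. Qed.

Let J0 : 0 < J%:R :> R.
Proof. by rewrite ltr0n. Qed.

Lemma grid_homo : {homo grid : i k / (i <= k)%N >-> i <= k}.
Proof.
move=> i k ik; rewrite ler_pM2r // lerD2r ler_pM2r // ler_pM2r ?invr_gt0 //.
by rewrite ler_nat.
Qed.

Lemma laplace_grid_homo : {homo laplace_grid : i k / (i <= k)%N >-> i <= k}.
Proof.
move=> i k ik.
have /andP[s0 _] := survival_bounds (grid k) N1 g1 phig.
have /andP[_ s1] := survival_bounds (grid i) N1 g1 phig.
by apply: laplace_quantile_noninc => //; apply: survival_noninc => //; exact: grid_homo.
Qed.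

Lemma survival_laplace_grid i :
  survival N 1 (laplace_grid i) = survival N g (grid i).
Proof. by apply: survival_laplace_quantile => //; exact: survival_bounds. Qed.

Lemma grid0 : grid 0 = - (3 * N%:R).
Proof. by rewrite /grid mul0r mul0r sub0r mulNr. Qed.

Lemma grid_last : grid J.*2 = 3 * N%:R.
Proof. by rewrite /grid -mul2n natrM; field; rewrite gt_eqF. Qed.

Lemma grid_step i : grid i.+1 - grid i = 3 / J%:R * N%:R.
Proof. by rewrite /grid -natr1; field; rewrite gt_eqF. Qed.

Lemma laplace_grid_close i : (i <= J.*2)%N ->
  `|laplace_grid i - grid i| <= quantile_error.
Proof.
move=> iJ; apply: quantile_close => //; first by lra.
have N1' : 1 <= N%:R :> R by rewrite ler1n.
have h0 := grid_homo (leq0n i); have h1 := grid_homo iJ.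
rewrite grid0 in h0; rewrite grid_last in h1.
have : `|grid i| <= 3 * N%:R by rewrite ler_norml h0 h1.
by lra.
Qed.

Lemma same_cell_close j (x1 x2 : R) : (j < J.*2)%N ->
  laplace_grid j < x1 <= laplace_grid j.+1 -> grid j < x2 <= grid j.+1 ->
  `|x1 - x2| <= 3 / J%:R * N%:R + quantile_error.
Proof.
move=> jJ /andP[l1 u1] /andP[l2 u2].
have := laplace_grid_close (ltnW jJ); have := laplace_grid_close jJ.
rewrite !ler_norml => /andP[c1 c2] /andP[c3 c4].
have st := grid_step j.
by apply/andP; split; lra.
Qed.

(** The factor 3 in the range of the grid makes this small enough to beat the
    number 2^N of configurations, as 2 < e^2. *)
Lemma survival_far : g <= 2 ->
  1 - survival N g (grid 0) + survival N g (grid J.*2) <= expR (1 - 2 * N%:R).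
Proof.
move=> g2; have g0 : 0 < g by exact: lt_le_trans g1.
rewrite grid0 grid_last survivalN // subKr.
have T0 : 0 <= 3 * N%:R :> R by rewrite mulr_ge0.
have h := survival_le N1 g1 phig T0.
have C := phi_norm_le N1 g1 phig.
have e : N%:R * ((g - 1) / g) <= N%:R :> R.
  by rewrite ler_piMr // ler_pdivrMr // mul1r lerBlDr lerDl.
have : phi_norm N g * (expR (N%:R * ((g - 1) / g)) * expR (- (3 * N%:R)))
   <= expR 1 / 2 * (expR N%:R * expR (- (3 * N%:R))).
  apply: ler_pM => //; first exact: phi_norm_ge0.
  by rewrite ler_wpM2r ?expR_ge0 // ler_expR.
have -> : expR (1 - 2 * N%:R) = expR 1 * (expR N%:R * expR (- (3 * N%:R))) :> R.
  by rewrite -!expRD; congr expR; ring.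
by lra.
Qed.

(** The extreme cells are unbounded, so the first model is restricted to the event
    that no variable falls in them; the second model is in the same cells, hence
    avoids them too. *)
Lemma coupled_disorder d1 d2 (T1 : measurableType d1) (T2 : measurableType d2)
    (P1 : probability T1 R) (P2 : probability T2 R) (I : choiceType) (A : set I)
    (X1 : I -> {RV P1 >-> R}) (X2 : I -> {RV P2 >-> R}) (s : seq I)
    (E1 : set T1) (E2 : set T2) :
  iid_with_density A (phi N 1) X1 -> iid_with_density A (phi N g) X2 ->
  uniq s -> (forall i, i \in s -> A i) -> g <= 2 ->
  (size s)%:R * expR (1 - 2 * N%:R) <= 4^-1 :> R ->
  measurable E1 -> measurable E2 ->
  ((3 / 4)%:E < P1 E1)%E -> ((3 / 4)%:E < P2 E2)%E ->
  exists w1 w2, [/\ E1 w1, E2 w2 & forall i, i \in s ->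
    `|X1 i w1 - X2 i w2| <= 3 / J%:R * N%:R + quantile_error].
Proof.
move=> iid1 iid2 us sA g2 small mE1 mE2 P1E1 P2E2.
pose bad i := X1 i @^-1` (`]-oo, laplace_grid 0] `|` `]laplace_grid J.*2, +oo[).
have mbad i : measurable (bad i).
  by rewrite -[bad i]setTI; apply: measurable_funP => //; exact: measurableU.
pose Bad := \bigcup_(i in [set` s]) bad i.
have mBad : measurable Bad by apply: fin_bigcup_measurable.
have PBad : (P1 Bad <= (4^-1)%:E)%E.
  apply: (@le_trans _ _ ((size s)%:R * expR (1 - 2 * N%:R))%:E); last by rewrite lee_fin.
  apply: union_bound => // i si; apply: le_trans (_ : _ <=
      distribution P1 (X1 i) `]-oo, laplace_grid 0]%classic +
      distribution P1 (X1 i) `]laplace_grid J.*2, +oo[%classic)%E _.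
    exact: (@measureU2 _ _ _ (distribution P1 (X1 i))).
  rewrite (distribution_gt _ iid1) ?(distribution_le _ iid1) //; try exact: sA.
  by rewrite -EFinD lee_fin !survival_laplace_grid survival_far.
pose m := J.*2.+1.
have [w1 [w2 [[E1w1 nBad] E2w2 same]]] : exists w1 w2, [/\ (E1 `\` Bad) w1, E2 w2 &
    forall i, i \in s ->
      cell m laplace_grid (X1 i w1) = cell m grid (X2 i w2)].
  apply: (@coupling_by_cells _ _ _ _ _ _ _ _ A X1 X2 s m) => //.
  - exact: iid1.1.
  - exact: iid2.1.
  - by move=> x; exact: cell_le.
  - move=> j; rewrite cell_preimage //; last exact: laplace_grid_homo.
    by apply: measurableD; exact: measurable_cell_ge_set.
  - move=> j; rewrite cell_preimage //; last exact: grid_homo.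
    by apply: measurableD; exact: measurable_cell_ge_set.
  - move=> i j si.
    apply: (@cell_law _ (distribution P1 (X1 i)) (distribution P2 (X2 i))).
    + exact: laplace_grid_homo.
    + exact: grid_homo.
    + exact: (etrans (@probability_setT _ _ _ (distribution P1 (X1 i)))
        (esym (@probability_setT _ _ _ (distribution P2 (X2 i))))).
    + apply: le_lt_trans (ltry 1).
      exact: (@probability_le1 _ _ _ (distribution P1 (X1 i))).
    + move=> l _; apply: etrans (distribution_gt _ iid1 (lexx _) (sA _ si)) _.
      rewrite survival_laplace_grid.
      exact: esym (distribution_gt _ iid2 g1 (sA _ si)).
  - exact: measurableD.
  - have : (P1 E1 <= P1 (E1 `\` Bad) + P1 Bad)%E.
      apply: le_trans (measureU2 _ _ _) => //; last exact: measurableD.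
      apply: le_measure; rewrite ?inE //.
        by apply: measurableU => //; exact: measurableD.
      by move=> x Ex; have [|] := pselect (Bad x); [right|left].
    move: P1E1 P2E2 PBad.
    rewrite -(fineK (fin_num_measure P1 _ mE1)) -(fineK (fin_num_measure P2 _ mE2)).
    rewrite -(fineK (fin_num_measure P1 _ mBad)).
    rewrite -(fineK (fin_num_measure P1 _ (measurableD mE1 mBad))).
    by rewrite -!EFinD !lte_fin !lee_fin; lra.
exists w1, w2; split => // i si.
have ngood : ~ bad i w1 by move=> b; apply: nBad; exists i.
have l1 : laplace_grid 0 < X1 i w1.
  by rewrite ltNge; apply/negP => h; apply: ngood; left; rewrite /= in_itv.
have u1 : X1 i w1 <= laplace_grid J.*2.
  by rewrite leNgt; apply/negP => h; apply: ngood; right; rewrite /= in_itv /= h.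
have := same i si; case e : (cell m laplace_grid (X1 i w1)) => [|j] e'.
  have := @cell_gt _ m laplace_grid (X1 i w1) 0 laplace_grid_homo isT.
  by rewrite e ltnn l1.
have jJ : (j < J.*2)%N.
  rewrite ltnNge; apply/negP => jJ.
  have := @cell_gt _ m laplace_grid (X1 i w1) J.*2 laplace_grid_homo (ltnSn _).
  by rewrite e ltnS jJ ltNge u1.
have c th x : {homo th : i k / (i <= k)%N >-> i <= k} -> cell m th x = j.+1 ->
    th j < x <= th j.+1.
  move=> homo ec; apply/andP; split.
    by rewrite -(@cell_gt _ m) ?ec // ltnS ltnW.
  by rewrite leNgt -(@cell_gt _ m) ?ec ?ltnn // ltnS.
apply: (same_cell_close jJ); apply: c => //.
- exact: laplace_grid_homo.
- exact: grid_homo.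
Qed.

End Coupling.
End Comparison.
(** * Free energies *)

Section FreeEnergy.
Context {R : realType}.

(** Almost sure convergence implies convergence in probability, which is all that
    the coupling of the two probability spaces needs at a fixed N. *)
Lemma ae_cvg_eventually d (T : measurableType d) (P : probability T R)
    (Y : nat -> T -> R) (e eta : R) :
  (forall N, measurable_fun setT (Y N)) ->
  {ae P, forall w, Y N w @[N --> \oo] --> e} -> 0 < eta ->
  forall c : R, c < 1 -> \forall N \near \oo,
    measurable [set w | `|Y N w - e| < eta] /\
    (c%:E < P [set w | (`|Y N w - e| < eta)%R])%E.
Proof.
move=> mY [Nul [mNul Nul0 sub]] eta0 c c1.
pose A N := [set w | `|Y N w - e| < eta].
have mA N : measurable (A N).
  have mf : measurable_fun setT (fun w => `|Y N w - e|).
    by apply: measurableT_comp => //; exact: measurable_funB.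
  have -> : A N = setT `&` (fun w => `|Y N w - e|) @^-1` `]-oo, eta[%classic.
    by rewrite setTI; apply/seteqP; split => w; rewrite /A /= in_itv.
  exact: mf.
pose F M := \bigcap_(N in [set N | (M <= N)%N]) A N.
have mF M : measurable (F M) by apply: bigcap_measurableType => N _; exact: mA.
have mUF : measurable (\bigcup_M F M) by apply: bigcup_measurable => M _; exact: mF.
have cvgF : P (F M) @[M --> \oo] --> P (\bigcup_M F M).
  apply: nondecreasing_cvg_mu => // M M' MM'; apply/subsetPset => w h N /= MN.
  by apply: h; rewrite /= (leq_trans MM').
have PU : P (\bigcup_M F M) = 1%E.
  have : P (~` \bigcup_M F M) = 0%E.
    apply/eqP; rewrite eq_le measure_ge0 andbT -Nul0.
    apply: le_measure; rewrite ?inE //; first exact: measurableC.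
    move=> w nw; apply: sub => /= cw; apply: nw.
    move/cvgrPdist_lt: cw => /(_ _ eta0)[M _ hM].
    by exists M => // N MN; rewrite /A /= distrC; exact: hM.
  rewrite probability_setC // => h.
  have := @fineK _ (P (\bigcup_M F M)) (fin_num_measure P _ mUF).
  move: h; case: (P _) => //= r; rewrite -EFinB => -[h] _; congr EFin; lra.
have h : \forall M \near \oo, (c%:E < P (F M))%E.
  have := cvgF; rewrite PU => /(_ [set x | (c%:E < x)%E]); apply.
  by apply: open_nbhs_nbhs; split; [exact: open_ereal_gt_ereal|rewrite /= lte_fin].
apply: filterS h => N PN; split; first exact: mA.
apply: (lt_le_trans PN); apply: le_measure; rewrite ?inE //; first exact: mA.
by move=> w; apply; rewrite /=.
Qed.

Section Words.
Variables (n : nat) (k : nat -> nat -> nat) (N : nat).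

Definition prefixes : seq (seq bool) :=
  undup [seq level_prefix k N i (tval sigma) | sigma <- enum {: N.-tuple bool},
                                         i <- index_iota 1 n.+1].

Lemma mem_prefixes (sigma : N.-tuple bool) i : (1 <= i <= n)%N ->
  level_prefix k N i sigma \in prefixes.
Proof.
move=> hi; rewrite mem_undup; apply/allpairsP; exists (sigma, i).
by rewrite mem_enum mem_index_iota /= ltnS.
Qed.

Lemma prefixes_level_words w : (\sum_(1 <= i < n.+1) k i N)%N = N ->
  w \in prefixes -> level_words n k N w.
Proof.
move=> hN; rewrite mem_undup => /allpairsP[[sigma i]] /= [_ + ->].
rewrite mem_index_iota ltnS => hi; exists i; split => //.
rewrite /level_prefix size_takel // size_tuple /prefix_length -{2}hN.
by rewrite [leqRHS](@big_cat_nat _ _ _ i.+1) ?leq_addr // ltnS; case/andP: hi.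
Qed.

Lemma size_prefixes : (size prefixes <= n * 2 ^ N)%N.
Proof.
apply: (leq_trans (size_undup _)).
by rewrite size_allpairs -cardE card_tuple card_bool size_iota subn1 mulnC.
Qed.

End Words.

Lemma partition_function_gt0 d (T : measurableType d) n (a : nat -> R) k
    (xi : nat -> seq bool -> T -> R) (b : R) N (w : T) :
  0 < partition_function n a k xi b N w.
Proof.
rewrite /partition_function (bigD1 (nseq_tuple N true)) //=.
by rewrite ltr_pwDl ?expR_gt0 // sumr_ge0 // => i _; exact: expR_ge0.
Qed.

(** The exponent of each configuration changes by at most
    b (a_1 + ... + a_n) D. *)
Lemma ln_partition_function_le d1 d2 (T1 : measurableType d1)
    (T2 : measurableType d2) n (a : nat -> R) k
    (xi1 : nat -> seq bool -> T1 -> R) (xi2 : nat -> seq bool -> T2 -> R)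
    (b D : R) N w1 w2 :
  0 <= b -> (forall i, (1 <= i <= n)%N -> 0 < a i) ->
  (forall (sigma : N.-tuple bool) i, (1 <= i <= n)%N ->
    `|xi1 N (level_prefix k N i sigma) w1 - xi2 N (level_prefix k N i sigma) w2| <= D) ->
  ln (partition_function n a k xi1 b N w1) <=
  ln (partition_function n a k xi2 b N w2) + b * (\sum_(1 <= i < n.+1) a i) * D.
Proof.
move=> b0 ha h; set S := \sum_(1 <= i < n.+1) a i.
rewrite -[b * S * D]expRK -lnM ?posrE ?expR_gt0 ?partition_function_gt0 //.
rewrite ler_ln ?posrE ?mulr_gt0 ?expR_gt0 ?partition_function_gt0 //.
rewrite /partition_function mulr_suml; apply: ler_sum => sigma _.
rewrite -expRD ler_expR -mulrA -[- (b * _)]mulrN -[- (b * _)]mulrN -mulrDr.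
rewrite ler_wpM2l // /Hamiltonian -lerBlDl opprK -sumrN -big_split /=.
rewrite mulr_suml big_nat [leRHS]big_nat; apply: ler_sum => i hi.
rewrite -mulrN -mulrDr ler_wpM2l ?(ltW (ha _ _)) //.
have := h sigma i hi; rewrite ler_norml => /andP[h1 h2].
lra.
Qed.

Lemma ln_partition_function_close d1 d2 (T1 : measurableType d1)
    (T2 : measurableType d2) n (a : nat -> R) k
    (xi1 : nat -> seq bool -> T1 -> R) (xi2 : nat -> seq bool -> T2 -> R)
    (b D : R) N w1 w2 :
  0 <= b -> (forall i, (1 <= i <= n)%N -> 0 < a i) ->
  (forall (sigma : N.-tuple bool) i, (1 <= i <= n)%N ->
    `|xi1 N (level_prefix k N i sigma) w1 - xi2 N (level_prefix k N i sigma) w2| <= D) ->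
  `|ln (partition_function n a k xi1 b N w1) -
    ln (partition_function n a k xi2 b N w2)| <= b * (\sum_(1 <= i < n.+1) a i) * D.
Proof.
move=> b0 ha h.
have h1 := ln_partition_function_le b0 ha h.
have h2 : ln (partition_function n a k xi2 b N w2) <=
  ln (partition_function n a k xi1 b N w1) + b * (\sum_(1 <= i < n.+1) a i) * D.
  by apply: ln_partition_function_le => // sigma i hi; rewrite distrC; exact: h.
by rewrite ler_norml; apply/andP; split; lra.
Qed.

Lemma measurable_free_energy d (T : measurableType d) (P : probability T R)
    n (a : nat -> R) k (xi : nat -> seq bool -> {RV P >-> R}) (b : R) N :
  measurable_fun setT (fun w => N%:R^-1 *
    ln (partition_function n a k (fun N s => xi N s) b N w)).
Proof.
apply: measurable_funM => //; apply: measurableT_comp => //.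
apply: measurable_sum => sigma; apply: measurableT_comp => //.
apply: measurableT_comp => //; apply: measurable_funM => //.
apply: measurable_sum => i; exact: measurable_funM.
Qed.

Lemma exponentially_few n : \forall N \near \oo,
  (n * 2 ^ N)%:R * expR (1 - 2 * N%:R) <= 4^-1 :> R.
Proof.
have e3 : 3 <= expR 2 :> R.
  by apply: le_trans (expR_ge1Dx 2); lra.
have h : n%:R * expR 1 * (2 / expR 2) ^+ N @[N --> \oo] --> (n%:R * expR 1 * 0 : R).
  apply: cvgMl_tmp; apply: cvg_expr.
  rewrite ger0_norm ?divr_ge0 ?expR_ge0 // ltr_pdivrMr ?expR_gt0 //.
  by lra.
rewrite mulr0 in h.
near=> N.
have -> : (n * 2 ^ N)%:R * expR (1 - 2 * N%:R) = n%:R * expR 1 * (2 / expR 2) ^+ N :> R.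
  by rewrite natrM natrX expRD expRN expRM_natr exprMn exprVn; ring.
near: N; apply: (cvgr_le _ h); lra.
Unshelve. all: by end_near. Qed.

End FreeEnergy.
(** * Continuity at g = 1 *)

Section Continuity.
Context {R : realType}.

(** The displacement per spin of the transported disorder, once the mesh of the
    discretization has gone to 0: the first term comes from the lower bound on the
    rate function, the second one from its upper bound on [0, 4N]. *)
Definition modulus (g : R) : R := (g - 1) / g + 4 * (4 `^ (g - 1) - 1).

(** Both limits are constants, so it is enough to find, for one large N, a point
    in each probability space at which the free energy is close to its limit, such
    that the two disorders are close at these points. *)
Lemma free_energy_close (n : nat) (a p : nat -> R) (k : nat -> nat -> nat)
    d1 d2 (T1 : measurableType d1) (T2 : measurableType d2)
    (P1 : probability T1 R) (P2 : probability T2 R)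
    (xi1 : nat -> seq bool -> {RV P1 >-> R}) (xi2 : nat -> seq bool -> {RV P2 >-> R})
    (g b e1 e2 : R) :
  (1 <= n)%N -> (forall i, (1 <= i <= n)%N -> 0 < a i) ->
  admissible_sizes n p k -> 1 <= g <= 2 -> 0 <= b ->
  GREM_disorder n k 1 xi1 -> GREM_disorder n k g xi2 ->
  limiting_free_energy n a k xi1 b e1 -> limiting_free_energy n a k xi2 b e2 ->
  `|e1 - e2| <= b * (\sum_(1 <= i < n.+1) a i) * modulus g.
Proof.
move=> n1 ha [_ hk _] /andP[g1 g2] b0 dis1 dis2 lim1 lim2.
set S := b * _.
have S0 : 0 <= S.
  rewrite /S mulr_ge0 // big_nat; apply: sumr_ge0 => i hi.
  by apply/ltW/ha; lia.
apply/ler_addgt0Pr => eps eps0.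
(* Half of eps is spent on the mesh 3 / J and on 1 / N <= 1 / J, the other half
   on the distances to the two limits. *)
have [J J1 hJ] : exists2 J, (1 <= J)%N & S * 4 / J%:R <= eps / 2.
  exists (Num.bound (S * 8 / eps)).+1 => //.
  rewrite ler_pdivrMr ?ltr0n //.
  have := archi_boundP (divr_ge0 (mulr_ge0 S0 (ler0n R 8)) (ltW eps0)).
  rewrite ltr_pdivrMr // -natr1 => h.
  by rewrite mulrDr; lra.
have eta0 : 0 < eps / 4 by lra.
have c1 : 3 / 4 < 1 :> R by lra.
have [M1 _ ev1] :=
  ae_cvg_eventually (measurable_free_energy n a k xi1 b) lim1 eta0 c1.
have [M2 _ ev2] :=
  ae_cvg_eventually (measurable_free_energy n a k xi2 b) lim2 eta0 c1.
have [M3 _ few] := exponentially_few (R := R) n.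
pose N := (n + J + M1 + M2 + M3)%N.
have nN : (n <= N)%N by rewrite /N; lia.
have JN : (J <= N)%N by rewrite /N; lia.
have N1 : (1 <= N)%N := leq_trans n1 nN.
have [|mE1 PE1] := ev1 N; first by rewrite /N /=; lia.
have [|mE2 PE2] := ev2 N; first by rewrite /N /=; lia.
have fewN : (n * 2 ^ N)%:R * expR (1 - 2 * N%:R) <= 4^-1 :> R.
  by apply: few; rewrite /N /=; lia.
have sA w : w \in prefixes n k N -> level_words n k N w.
  by apply: prefixes_level_words; exact: hk.
have w0 : level_words n k N (level_prefix k N 1 (nseq_tuple N true)).
  by apply: sA; apply: mem_prefixes.
have phi1 := iid_density_integral (dis1 N nN) w0.
have phig := iid_density_integral (dis2 N nN) w0.
have small : (size (prefixes n k N))%:R * expR (1 - 2 * N%:R) <= 4^-1 :> R.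
  apply: le_trans fewN; rewrite ler_wpM2r ?expR_ge0 // ler_nat.
  exact: size_prefixes.
have [w1 [w2 [/= E1w1 E2w2 close]]] := coupled_disorder N1 J1 g1 phig phi1
  (dis1 N nN) (dis2 N nN) (undup_uniq _) sA g2 small mE1 mE2 PE1 PE2.
have lnZ := ln_partition_function_close (xi1 := fun N s => xi1 N s)
  (xi2 := fun N s => xi2 N s) b0 ha (fun sigma i hi => close _ (mem_prefixes k sigma hi)).
have N0 : 0 < N%:R :> R by rewrite ltr0n.
have J0 : 0 < J%:R :> R by rewrite ltr0n.
move: E1w1 E2w2 lnZ.
set z1 := ln _; set z2 := ln _ => E1w1 E2w2 lnZ.
have {}lnZ : `|N%:R^-1 * z1 - N%:R^-1 * z2| <= S * modulus g + S * 4 / J%:R.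
  rewrite -mulrBr normrM ger0_norm ?invr_ge0 // ler_pdivrMl //.
  apply: (le_trans lnZ); rewrite -/S /quantile_error /modulus.
  have -> : N%:R * (S * ((g - 1) / g + 4 * (4 `^ (g - 1) - 1)) + S * 4 / J%:R) =
     S * (3 / J%:R * N%:R + (N%:R * ((g - 1) / g) + N%:R / J%:R
           + 4 * N%:R * (4 `^ (g - 1) - 1))) by ring.
  rewrite ler_wpM2l // lerD2l lerD2r lerD2l ler_pdivlMr // mul1r ler_nat //.
have -> : e1 - e2 = - (N%:R^-1 * z1 - e1) + (N%:R^-1 * z1 - N%:R^-1 * z2)
   + (N%:R^-1 * z2 - e2) by ring.
apply: (le_trans (ler_normD _ _)).
apply: (le_trans (lerD (ler_normD _ _) (lexx _))).
rewrite normrN; lra.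
Qed.

Lemma modulus_cvg : modulus g @[g --> (1 : R)^'+] --> (0 : R).
Proof.
have g1 : g @[g --> (1:R)^'+] --> (1:R) by apply: cvg_at_right_filter; exact: cvg_id.
have gm1 : (g - 1) @[g --> (1:R)^'+] --> (0:R).
  by rewrite -(subrr 1); apply: cvgB => //; exact: cvg_cst.
have -> : (0 : R) = 0 * 1^-1 + 4 * (1 - 1) by ring.
apply: cvgD.
  by apply: cvgM => //; apply: cvgV => //; rewrite oner_eq0.
apply: cvgMl_tmp; apply: cvgB; last exact: cvg_cst.
apply: (@cvg_powR_exponent0 _ (fun=> 4) _ _ 4) => //; exact: cvg_cst.
Qed.

End Continuity.

Theorem theorem2p6p4 (R : realType) (n : nat) (a p : nat -> R)
  (hn : (1 <= n)%N)
  (ha : forall i, (1 <= i <= n)%N -> 0 < a i)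
  (hp : forall i, (1 <= i <= n)%N -> 0 <= p i)
  (hp1 : 0 < p 1%N)
  (hsum : \sum_(1 <= i < n.+1) p i = 1) :
  (* the limiting free energies of the models, as almost sure limits *)
  (forall (k : nat -> nat -> nat) (d : R -> measure_display)
      (T : forall g : R, measurableType (d g))
      (P : forall g : R, probability (T g) R)
      (xi : forall g : R, nat -> seq bool -> {RV (P g) >-> R})
      (E : R -> R -> R),
    admissible_sizes n p k ->
    (forall g, 1 <= g -> GREM_disorder n k g (xi g)) ->
    (forall g b, 1 <= g -> 0 <= b ->
      limiting_free_energy n a k (xi g) b (E g b)) ->
    forall b, 0 <= b -> E g b @[g --> 1^'+] --> E 1 b)
  /\
  (* the explicit formulas for them *)
  (forall b, 0 <= b ->
    free_energy_gamma n a p g b @[g --> 1^'+] --> free_energy_exp n a p b).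
Proof.
split; last by move=> b b0; exact: free_energy_gamma_cvg.
move=> k d T P xi E hk dis lim b b0.
set S := b * \sum_(1 <= i < n.+1) a i.
have cvgS : S * modulus g @[g --> (1 : R)^'+] --> (0 : R).
  rewrite -(mulr0 S); apply: cvgMl_tmp; exact: modulus_cvg.
apply/cvgrPdist_le => eps eps0; near=> g.
have g1 : 1 < g by near: g; exact: nbhs_right_gt.
have g2 : g <= 2 by near: g; apply: nbhs_right_le; lra.
apply: (@le_trans _ _ (S * modulus g)).
  by apply: (free_energy_close hn ha hk _ b0 (dis _ (lexx _)) (dis _ (ltW g1))
    (lim _ _ (lexx _) b0) (lim _ _ (ltW g1) b0)); rewrite ltW.
near: g; exact: (cvgr_le _ cvgS).
Unshelve. all: by end_near. Qed.
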